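(* Let $1<p<\infty$ and let $\Gamma$ be an uncountable set. Let $\Pi,\Delta$ be sets such that $\aleph_0<|\Pi|<|\Gamma|$ and $\aleph_0<|\Delta|<|\Gamma|$. Then $\ell^{p,\infty}(\Gamma)\oplus F(\Pi)$ is isomorphic to $\ell^{p,\infty}(\Gamma)\oplus F(\Delta)$ if and only if $|\Pi|=|\Delta|$.
   Context: For a set $S$ and $w:S\to(0,\infty)$, $\ell^{p,\infty}(S,w)$ is the space of all $x:S\to\mathbb{R}$ with $\|x\|=\sup_{c>0}c\,(\mu\{|x|>c\})^{1/p}<\infty$, where $\mu(A)=\sum_{s\in A}w(s)$ for $A\subseteq S$. This expression is equivalent to a norm under which the space is a Banach space. $\ell^{p,\infty}(S)$ denotes the case $w\equiv1$. ''Isomorphic'' means linearly homeomorphic. $|A|$ denotes the cardinality of $A$. For a set $S$, $F(S)$ denotes $\ell^{p,\infty}(S\times\mathbb{N},w)$ with $w(s,n)=2^{-n}$ for $s\in S$, $n\in\mathbb{N}=\{1,2,\ldots\}$. *)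

(* Defs.v *)
From HB Require Import structures.
From mathcomp Require Import all_boot all_order all_algebra.
From mathcomp Require Import all_classical all_reals all_analysis.

Set Implicit Arguments.
Unset Strict Implicit.
Unset Printing Implicit Defensive.

Import Order.TTheory GRing.Theory Num.Theory.
Import numFieldNormedType.Exports.

Local Open Scope classical_set_scope.
Local Open Scope ring_scope.

Local Open Scope card_scope.

Section quasinorm.
Context {R : realType} {S : choiceType}.
Implicit Types (p a c : R) (w : S -> {posnum R}) (x y : S -> R) (A B : set S).

Definition wmass w A : \bar R := (\esum_(s in A) ((w s)%:num)%:E)%E.

Definition weak_norm (p : R) w x : \bar R :=
  ereal_sup [set (c%:E * wmass w [set s | (c < `|x s|)%R] `^ p^-1)%E
            | c in [set c : R | 0 < c]].

Lemma wmass_ge0 w A : (0 <= wmass w A)%E.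
Proof. by apply: esum_ge0 => s _; rewrite lee_fin. Qed.

Lemma wmassU w A B C : A `<=` B `|` C ->
  (wmass w A <= wmass w B + wmass w C)%E.
Proof.
move=> ABC; rewrite /wmass esum_mkcond [X in (_ <= X + _)%E]esum_mkcond.
rewrite [X in (_ <= _ + X)%E]esum_mkcond -esumD; last 2 first.
- by move=> s _; case: ifP => // _; rewrite lee_fin.
- by move=> s _; case: ifP => // _; rewrite lee_fin.
apply: le_esum => s _; case: ifPn => [|_].
  rewrite inE => /ABC [Bs|Cs].
    rewrite (mem_set Bs) leeDl//; case: ifP => // _; by rewrite lee_fin.
  rewrite (mem_set Cs) leeDr//; case: ifP => // _; by rewrite lee_fin.
by apply: adde_ge0; case: ifP => // _; rewrite lee_fin.
Qed.

Lemma weak_norm_ub p w x c : 0 < c ->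
  (c%:E * wmass w [set s | (c < `|x s|)%R] `^ p^-1 <= weak_norm p w x)%E.
Proof. by move=> c0; apply: ereal_sup_ubound; exists c. Qed.

Lemma weak_norm_ge0 p w x : (0 <= weak_norm p w x)%E.
Proof.
apply: (@le_trans _ _ (1 * wmass w [set s | (1 < `|x s|)%R] `^ p^-1)%E).
  by rewrite mul1e poweR_ge0.
exact: weak_norm_ub.
Qed.

Lemma weak_norm0 p w : 0 < p -> weak_norm p w 0 = 0%E.
Proof.
move=> p0; apply/eqP; rewrite eq_le weak_norm_ge0 andbT.
apply: ge_ereal_sup => _ [c /= c0 <-].
rewrite (_ : [set s | _] = set0); last first.
  apply/seteqP; split => s //=; by rewrite normr0 ltNge ltW.
by rewrite /wmass esum_set0 poweR0r ?mule0// invr_neq0// gt_eqF.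
Qed.

Lemma weak_normN p w x : weak_norm p w (- x) = weak_norm p w x.
Proof.
rewrite /weak_norm; congr (ereal_sup (image _ _)); apply/funext => c.
by congr (_ * wmass w _ `^ _)%E; apply/seteqP; split => s /=; rewrite normrN.
Qed.

Lemma weak_normZ p w a x : 0 < p ->
  (weak_norm p w (a *: x)%R <= `|a|%:E * weak_norm p w x)%E.
Proof.
move=> p0; have [->|a0] := eqVneq a 0.
  by rewrite scale0r weak_norm0// normr0 mul0e.
have a1 : 0 < `|a| by rewrite normr_gt0.
apply: ge_ereal_sup => _ [c /= c0 <-].
rewrite (_ : [set s | _] = [set s | c / `|a| < `|x s|]); last first.
  apply/seteqP; split => s /=; by rewrite normrM ltr_pdivrMr// mulrC.
have -> : c%:E = (`|a|%:E * (c / `|a|)%:E)%E.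
  by rewrite -EFinM mulrCA divff ?mulr1// gt_eqF.
by rewrite -muleA lee_pmul2l ?lte_fin// weak_norm_ub// divr_gt0.
Qed.

Lemma weak_normD p w : 0 < p -> exists2 K : R, 0 < K & forall x y,
  (weak_norm p w (x + y)%R
    <= K%:E * (weak_norm p w x + weak_norm p w y))%E.
Proof.
move=> p0; have q0 : 0 <= p^-1 by rewrite invr_ge0 ltW.
have k0 : 0 < 2 `^ p^-1 :> R by rewrite powR_gt0.
exists (2 * 2 `^ p^-1); first by rewrite mulr_gt0.
move=> x y; apply: ge_ereal_sup => _ [c /= c0 <-].
have c20 : 0 < c / 2 by rewrite divr_gt0.
set a := wmass w [set s | c / 2 < `|x s|].
set b := wmass w [set s | c / 2 < `|y s|].
have a0 : (0 <= a)%E := wmass_ge0 _ _.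
have b0 : (0 <= b)%E := wmass_ge0 _ _.
have mab : (wmass w [set s | (c < `|(x + y)%R s|)%R] <= a + b)%E.
  apply: wmassU => s /= cs; apply/orP; rewrite -implyNb -leNgt.
  apply/implyP => xs; rewrite ltNge; apply/negP => ys.
  move: cs; rewrite ltNge => /negP; apply.
  by rewrite (le_trans (ler_normD _ _))// [leRHS]splitr lerD.
have mono : forall u v : \bar R, (0 <= u -> u <= v -> u `^ p^-1 <= v `^ p^-1)%E.
  move=> u v u0 uv; apply: gt0_ler_poweR => //.
    by rewrite in_itv/= u0 leey.
  by rewrite in_itv/= (le_trans u0 uv) leey.
have two : forall u v : \bar R,
  (0 <= u -> u <= v -> (u + v) `^ p^-1 <= (2 `^ p^-1)%:E * (u `^ p^-1 + v `^ p^-1))%E.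
  move=> u v u0 uv; have v0 := le_trans u0 uv.
  apply: (@le_trans _ _ ((2%:E * v) `^ p^-1)%E).
    by apply: mono; [exact: adde_ge0|rewrite mule_natl mule2n leeD].
  rewrite poweRM ?lee_fin// poweR_EFin lee_pmul2l ?lte_fin//.
  by rewrite leeDr ?poweR_ge0.
have ab : ((a + b) `^ p^-1 <= (2 `^ p^-1)%:E * (a `^ p^-1 + b `^ p^-1))%E.
  have [|/ltW] := leP a b; first exact: two.
  by rewrite addeC [X in (_ <= _ * X)%E]addeC; exact: two.
apply: (@le_trans _ _ (c%:E * ((2 `^ p^-1)%:E * (a `^ p^-1 + b `^ p^-1)))%E).
  rewrite lee_pmul2l ?lte_fin//; apply: le_trans ab.
  by apply: mono => //; exact: wmass_ge0.
rewrite (_ : c%:E = (2%:E * (c / 2)%:E)%E); last first.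
  by rewrite -EFinM mulrCA divff ?mulr1.
rewrite [X in (_ <= X * _)%E]EFinM -!muleA lee_pmul2l ?lte_fin//.
rewrite muleCA lee_pmul2l ?lte_fin//.
by rewrite ge0_muleDr ?poweR_ge0// leeD// weak_norm_ub.
Qed.

End quasinorm.

Section weak_lp.
Context {R : realType} {S : choiceType} {p : R}.

(* The exponent enters through the proof that 1 < p, so that the vector space
   and uniform structures below can be inferred from the type alone. *)
Definition weak_lp_pred (p1 : 1 < p) (w : S -> {posnum R}) : {pred S -> R} :=
  mem [set x : S -> R | (weak_norm p w x < +oo)%E].

Record weak_lp (p1 : 1 < p) (w : S -> {posnum R}) := WeakLp {
  weak_lp_fun :> S -> R ;
  weak_lp_mem : weak_lp_fun \in weak_lp_pred p1 w }.

Context (p1 : 1 < p) (w : S -> {posnum R}).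

Let p0 : 0 < p. Proof. exact: lt_trans p1. Qed.

HB.instance Definition _ := [isSub for @weak_lp_fun p1 w].
HB.instance Definition _ := [Choice of weak_lp p1 w by <:].

Lemma weak_lp_submod_closed : submod_closed (weak_lp_pred p1 w).
Proof.
split=> [|a x y]; first by rewrite inE/= weak_norm0.
rewrite !inE/= => xoo yoo; have [K K0 KD] := weak_normD w p0.
apply: le_lt_trans (KD _ _) _.
rewrite lte_mul_pinfty ?lee_fin ?ltW// lte_add_pinfty//.
apply: le_lt_trans (weak_normZ _ _ _ p0) _.
by rewrite lte_mul_pinfty// lee_fin.
Qed.

HB.instance Definition _ := GRing.isSubmodClosed.Build R (S -> R)
  (weak_lp_pred p1 w) weak_lp_submod_closed.
HB.instance Definition _ := [SubChoice_isSubLmodule of weak_lp p1 w by <:].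

Implicit Types x y z : weak_lp p1 w.

(* The uniform structure (hence the topology) of the quasi-norm: it is the one
   of any norm equivalent to weak_norm. *)
Definition weak_lp_entourage : set_system (weak_lp p1 w * weak_lp p1 w) :=
  [set E | exists2 e : R, 0 < e &
    forall x y, (weak_norm p w (x \- y)%R < e%:E)%E -> E (x, y)].

Lemma weak_lp_entourage_filter : Filter weak_lp_entourage.
Proof.
split; first by exists 1.
  move=> E F [e e0 eE] [f f0 fF]; exists (Num.min e f).
    by rewrite lt_min e0.
  move=> x y; rewrite EFin_min lt_min => /andP[xe xf].
  by split; [exact: eE|exact: fF].
by move=> E F EF [e e0 eE]; exists e => // x y /eE /EF.
Qed.

Lemma weak_lp_entourage_refl E : weak_lp_entourage E -> diagonal `<=` E.
Proof.
move=> [e e0 eE] [x y]; rewrite /diagonal/= => xy.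
apply: eE; rewrite xy (_ : y \- y = 0) ?weak_norm0 ?lte_fin//.
by apply/funext => s; exact: subrr.
Qed.

Lemma weak_lp_entourage_inv E :
  weak_lp_entourage E -> weak_lp_entourage (E^-1)%relation.
Proof.
move=> [e e0 eE]; exists e => // x y xy; apply: eE.
rewrite (_ : y \- x = - (x \- y)) ?weak_normN//.
by apply/funext => s; rewrite /= -opprB.
Qed.

Lemma weak_lp_entourage_split E : weak_lp_entourage E ->
  exists2 F, weak_lp_entourage F & (F \; F `<=` E)%relation.
Proof.
move=> [e e0 eE]; have [K K0 KD] := weak_normD w p0.
have d0 : 0 < e / K / 2 by rewrite !divr_gt0.
exists [set xy : weak_lp p1 w * weak_lp p1 w |
    (weak_norm p w (xy.1 \- xy.2)%R < (e / K / 2)%:E)%E].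
  by exists (e / K / 2).
move=> [x z] [y /= xy yz]; apply: eE.
rewrite (_ : x \- z = (x \- y) + (y \- z)); last first.
  by apply/funext => s; rewrite [RHS]addrA subrK.
apply: le_lt_trans (KD (x \- y) (y \- z)) _.
have -> : e%:E = (K%:E * ((e / K / 2)%:E + (e / K / 2)%:E))%E.
  by rewrite -EFinD -splitr -EFinM mulrCA divff ?mulr1// gt_eqF.
by rewrite lte_pmul2l ?lte_fin// lteD.
Qed.

HB.instance Definition _ := @isUniform.Build (weak_lp p1 w) weak_lp_entourage
  weak_lp_entourage_filter weak_lp_entourage_refl weak_lp_entourage_inv
  weak_lp_entourage_split.

End weak_lp.

(* Joins the library's product topology and product module structure. *)
HB.instance Definition _ (K : numDomainType) (V W : preTopologicalLmodType K) :=
  Topological.on (V * W)%type.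

Definition weak_lp1 {R : realType} {p : R} (p1 : 1 < p) (S : choiceType) :=
  weak_lp p1 (fun _ : S => 1%:pos).

(* The index n : nat stands for the positive integer n.+1. *)
Definition weak_lpF {R : realType} {p : R} (p1 : 1 < p) (S : choiceType) :=
  weak_lp p1 (fun sn : S * nat => (2^-1 ^+ sn.2.+1)%:pos).

Definition isomorphic {K : numDomainType} (V W : preTopologicalLmodType K) :=
  exists (f : {linear V -> W}) (g : W -> V),
    [/\ cancel f g, cancel g f, continuous f & continuous g].

Definition card_lt {T U : Type} (A : set T) (B : set U) : Prop :=
  A #<= B /\ ~ (B #<= A).

(* Main.v *)
Require Import Defs.
From HB Require Import structures.
From mathcomp Require Import all_boot all_order all_algebra.
From mathcomp Require Import all_classical all_reals all_analysis.
From mathcomp Require Import ring lra.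

Set Implicit Arguments.
Unset Strict Implicit.
Unset Printing Implicit Defensive.

Import Order.TTheory GRing.Theory Num.Theory.
Import numFieldNormedType.Exports.

Local Open Scope classical_set_scope.
Local Open Scope card_scope.
Local Open Scope ring_scope.

(** A bijection between the index sets reindexes [F] isometrically, so only the
forward implication has content. It suffices that an isomorphism [f] from
[l(Gamma) + F(Delta)] onto [l(Gamma) + F(Pi)], with [Pi] infinite, forces
[|Delta| <= |Pi|] ([isomorphic_card_le]): applied to [f] and to its inverse this
gives both inequalities, and Cantor-Bernstein concludes.

Let [a(s,n)] be the normalised unit vectors of [F(Delta)], that is the basis
vector at [(s,n)] times [2^((n+1)/p)], and look at the images [f(0, a(s,n))].

First, the components in [F(Pi)] vanish for most [s]. The sum of [N] vectors
[a(s,n)] with [n] fixed has norm [N^(1/p)], which is [o(N)] because [1 < p]; so a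
bounded functional is nonzero on [a(s,n)] for only countably many [s]
([countable_coord]). Since [F(Pi)] has [|Pi|] coordinates, the set of all [s] for
which some [f(0, a(s,n))] has a nonzero component in [F(Pi)] has cardinality at
most [|Pi|] ([card_le_of_countable_cover]).

Second, the set [A] of the remaining indices is countable: the rows indexed by
an uncountable set do not embed into [l(Gamma)] ([no_uncountable_embedding]).
Suppose they do, and let [u(s,n)] be the image of [a(s,n)], a function on
[Gamma].
- By the countability statement above, uncountably many [s] can be kept so that
  the functions [u(s,n)] attached to different [s] are disjointly supported
  ([uncountable_disjoint_supports]).
- For all but countably many [s], the quantity [z #{|u(s,n)|^p > z}] tends to [0]
  with [z] ([countable_fat_tails]). Otherwise, by the pigeonhole principle,
  uncountably many [u(s,n)] are large at the same heights [z = 2^-k], with [k] in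
  a set of any prescribed size [L]. Multiples of the [a(s,n)] with [2^(K-k)]
  indices [s] and factor [2^(k/p)] for each [k] then add up to a vector whose
  norm to the power [p] is at most [2^(K+1)], while all these heights are brought
  to the level [1] in the image, whose norm to the power [p] is at least a fixed
  multiple of [L 2^K].
- For fixed [s], sums of distinct [a(s,n)] are bounded, and a gliding hump shows
  that the sup norm of [u(s,n)] tends to [0] as [n] grows ([sup_norm_cvg0]).
- Hence there are [n_1 < ... < n_N] and uncountably many [s] for which the
  functions [|u(s,n_i)|^p] are concentrated, up to [e], on successive windows of
  heights going down as [i] grows ([separated_scales]). Take disjoint sets of
  [2^(n_i+1)] such indices [s], and let [x] be the indicator function of the
  corresponding pairs [(s,n_i)] in [F(Delta)]: its norm to the power [p] is [N].
  Its image is made of disjoint copies of the [u(s,n_i)] scaled by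
  [2^(-(n_i+1)/p)]. At height [z] these see the [u(s,n_i)] at the heights
  [z 2^(n_i+1)], which go up as [i] grows, so they meet the window of at most one
  [i]. The norm of the image to the power [p] is thus at most about [C + N e],
  which contradicts the lower bound for large [N] and small [e]. *)

(** * Masses and level sets *)

Section mass.
Context {R : realType} {S : choiceType}.
Implicit Types (w : S -> {posnum R}) (A B : set S).

Lemma le_wmass w A B : A `<=` B -> (wmass w A <= wmass w B)%E.
Proof.
move=> AB; rewrite /wmass esum_mkcond [leRHS]esum_mkcond; apply: le_esum => s _.
case: ifPn => [|_]; last by case: ifP => // _; rewrite lee_fin.
by rewrite inE => /AB As; rewrite (mem_set As).
Qed.

Lemma wmass_disjU w A B : A `&` B = set0 ->
  wmass w (A `|` B) = (wmass w A + wmass w B)%E.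
Proof.
move=> AB0; rewrite /wmass (esumID A); last by move=> s _; rewrite lee_fin.
congr (_ + _)%E; congr esum; first by rewrite setIUl setIid setUidl; last exact: subIsetr.
rewrite setIUl setICr set0U.
by apply/setIidPl/disjoints_subset; rewrite setIC.
Qed.

Lemma wmass_set1 w s : wmass w [set s] = ((w s)%:num)%:E.
Proof. by rewrite /wmass esum_set1// lee_fin. Qed.

Lemma wmass_seq w (G : seq S) : uniq G ->
  wmass w [set` G] = (\sum_(s <- G) (w s)%:num)%:E.
Proof.
elim: G => [_|s G IH /= /andP[sG uG]].
  by rewrite big_nil /wmass (_ : [set` _] = set0) ?esum_set0//; apply/seteqP; split.
rewrite big_cons EFinD -IH// -wmass_set1 -wmass_disjU.
  congr (wmass w _); apply/seteqP; split=> t /=; rewrite inE.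
    by case/orP => [/eqP ->|]; [left|right].
  by case=> [->|->]; rewrite ?eqxx ?orbT.
by apply/seteqP; split=> t //= [-> ]; rewrite (negPf sG).
Qed.

End mass.

Definition unit_weight {R : realType} {S : choiceType} : S -> {posnum R} :=
  fun=> 1%:pos.

Section counting.
Context {R : realType} {S : choiceType}.
Implicit Types (A : set S).

Lemma size_le_mass A (G : seq S) : uniq G -> [set` G] `<=` A ->
  ((size G)%:R%:E <= wmass (R := R) unit_weight A)%E.
Proof.
move=> uG GA; apply: le_trans (le_wmass _ GA).
by rewrite wmass_seq// big_const_seq count_predT iter_addr_0.
Qed.

Lemma infinite_set_seq A n : infinite_set A ->
  exists G : seq S, [/\ uniq G, size G = n & [set` G] `<=` A].
Proof.
move=> /(@infinite_set_fset _ A n)[B BA nB]; exists (take n (finmap.enum_fset B)).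
by split=> [||s /= /mem_take/BA//]; rewrite ?take_uniq ?finmap.fset_uniq ?size_takel.
Qed.

Lemma finite_mass_finite_set A :
  (wmass (R := R) unit_weight A < +oo)%E -> finite_set A.
Proof.
move=> Aoo; apply: contrapT => /infinite_set_seq Ainf.
set m := wmass _ A in Aoo; have A0 : (0 <= m)%E := wmass_ge0 _ _.
have Afin : m \is a fin_num by rewrite ge0_fin_numE.
have [G [uG sG GA]] := Ainf (Num.truncn (fine m)).+1.
have := size_le_mass uG GA; rewrite -/m -(fineK Afin) lee_fin sG leNgt => /negP; apply.
by rewrite truncnS_gt.
Qed.

End counting.

Section level.
Context {R : realType} {S : choiceType}.
Implicit Types (p z Q : R) (w : S -> {posnum R}) (x y : S -> R).

(** Heights are measured by [|x|^p] rather than by [|x|]: the powers of [2] carried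
    by the weights then meet powers of [2] in the heights, without any root. *)
Definition level p x z := [set s | z < `|x s| `^ p].

(** That is, the norm of [x] to the power [p] is at most [Q] ([weak_normP]). *)
Definition weak_le p w x Q :=
  forall z, 0 < z -> (wmass w (level p x z) <= (Q / z)%:E)%E.

Lemma weak_normP p w x M : 0 < p -> 0 <= M ->
  (weak_norm p w x <= M%:E)%E <-> weak_le p w x (M `^ p).
Proof.
move=> p0 M0; have p'0 : 0 < p^-1 by rewrite invr_gt0.
have E c : 0 < c -> level p x (c `^ p) = [set s | c < `|x s|].
  move=> c0; rewrite /level; apply/seteqP; split=> s /=; last first.
    by move=> cx; rewrite gt0_ltr_powR// nnegrE ltW.
  rewrite ltNge => H; rewrite ltNge; apply: contra H => H.
  by rewrite ge0_ler_powR ?nnegrE// ltW.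
have K (a : R) : 0 <= a -> (a `^ p) `^ p^-1 = a.
  by move=> a0; rewrite -powRrM mulfV ?powRr1// gt_eqF.
have K' (a : R) : 0 <= a -> (a `^ p^-1) `^ p = a.
  by move=> a0; rewrite -powRrM mulVf ?powRr1// gt_eqF.
have Q c (m : \bar R) : 0 < c -> (0 <= m)%E ->
    (c%:E * m `^ p^-1 <= M%:E)%E = (m <= (M `^ p / c `^ p)%:E)%E.
  move=> c0; case: m => [m| |] // m0; last first.
    by rewrite poweRyr ?gt_eqF// gt0_muley ?lte_fin// !leye_eq.
  rewrite poweR_EFin -EFinM !lee_fin mulrC -ler_pdivlMr//.
  rewrite lee_fin in m0.
  have -> : M `^ p / c `^ p = (M / c) `^ p.
    by rewrite powRM ?invr_ge0 ?(ltW c0)// -(powR_inv1 (ltW c0)) powRAC powR_inv1 ?powR_ge0.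
  have Mc : 0 <= M / c by rewrite divr_ge0// ltW.
  apply/idP/idP => H.
    by rewrite -(K' m m0); apply: ge0_ler_powR; rewrite ?nnegrE ?powR_ge0// ltW.
  by rewrite -(K (M / c))//; apply: ge0_ler_powR; rewrite ?nnegrE ?powR_ge0// ltW.
split=> [H z z0|H].
  have z'0 : 0 < z `^ p^-1 by rewrite powR_gt0.
  rewrite -(K' z (ltW z0)) -Q ?wmass_ge0// E//.
  by apply: le_trans H; exact: weak_norm_ub.
apply: ge_ereal_sup => _ [c /= c0 <-]; rewrite Q ?wmass_ge0//.
by rewrite -E//; apply: H; rewrite powR_gt0.
Qed.

Lemma weak_le_coord p w x Q s : 0 < Q -> weak_le p w x Q ->
  `|x s| `^ p * (w s)%:num <= Q.
Proof.
move=> Q0 H; rewrite leNgt; apply/negP => Qx.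
have w0 : 0 < (w s)%:num by [].
pose z := (Q / (w s)%:num + `|x s| `^ p) / 2.
have zlt : Q / (w s)%:num < `|x s| `^ p by rewrite ltr_pdivrMr.
have Qz : Q / (w s)%:num < z by rewrite midf_lt.
have z0 : 0 < z by apply: lt_trans Qz; rewrite divr_gt0.
have /(le_wmass w) : [set s] `<=` level p x z by move=> _ ->; rewrite /level/= midf_lt.
rewrite wmass_set1 => /le_trans/(_ (H _ z0)); rewrite lee_fin.
by rewrite ler_pdivlMr// mulrC -ler_pdivlMr// leNgt Qz.
Qed.

End level.

(** * Combinations of disjointly supported functions *)

Section disjoint_sums.
Context {R : realType} {S : choiceType}.
Variables (p : R) (w : S -> {posnum R}).
Hypothesis p0 : 0 < p.
Implicit Types (x y : S -> R) (z : R).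

Lemma level0 x z : 0 < z -> (forall s, x s = 0) -> level p x z = set0.
Proof.
move=> z0 x0; apply/seteqP; split=> s //; rewrite /level/= x0 normr0 powR0 ?gt_eqF//.
by rewrite ltNge ltW.
Qed.

Lemma wmass_level_disjD x y z : 0 < z -> (forall s, x s = 0 \/ y s = 0) ->
  wmass w (level p (fun s => x s + y s) z) =
  (wmass w (level p x z) + wmass w (level p y z))%E.
Proof.
move=> z0 xy; rewrite -wmass_disjU.
  congr (wmass w _); rewrite /level; apply/seteqP; split=> s /=.
    by case: (xy s) => ->; rewrite ?add0r ?addr0; [right|left].
  by case: (xy s) => ->; rewrite ?add0r ?addr0 normr0 powR0 ?gt_eqF//;
    case=> //; rewrite ltNge ltW.
apply/seteqP; split=> s //; rewrite /level/= => -[].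
by case: (xy s) => ->; rewrite normr0 powR0 ?gt_eqF// [z < 0]ltNge ltW.
Qed.

Definition lin_comb {K : Type} (V : K -> S -> R) (I : seq (R * K)) : S -> R :=
  fun s => \sum_(i <- I) i.1 * V i.2 s.

(** The label [h] allows keys to be identified before asking for disjointness: it
    is the identity for the atoms of [F], and the row index for their images. *)
Lemma wmass_level_lin_comb {K : Type} {T : eqType} (h : K -> T)
    (V : K -> S -> R) (I : seq (R * K)) z : 0 < z ->
  uniq [seq h i.2 | i <- I] ->
  (forall k l, h k \in [seq h i.2 | i <- I] -> h l \in [seq h i.2 | i <- I] ->
    h k != h l -> forall s, V k s = 0 \/ V l s = 0) ->
  wmass w (level p (lin_comb V I) z) =
  (\sum_(i <- I) wmass w (level p (fun s => (i.1 * V i.2 s)%R) z))%E.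
Proof.
move=> z0; elim: I => [_ _|i I IH /= /andP[hi uI] dI].
  rewrite big_nil level0//; last by move=> s; rewrite /lin_comb big_nil.
  by rewrite /wmass esum_set0.
rewrite big_cons -IH//; last first.
  by move=> k l kI lI; apply: dI; rewrite inE (kI, lI) orbT.
rewrite -wmass_level_disjD//.
  by congr (wmass w (level p _ z)); apply/funext => s; rewrite /lin_comb big_cons.
move=> s; have [->|Vi] := eqVneq (V i.2 s) 0; first by left; rewrite mulr0.
right; rewrite /lin_comb; elim: I hi dI {IH uI} => [|j I IH] hi dI.
  by rewrite big_nil.
move: hi; rewrite /= inE negb_or => /andP[hij hi].
rewrite big_cons IH//; last first.
  move=> k l kI lI; apply: dI.
    by move: kI; rewrite !inE => /orP[->//|->]; rewrite !orbT.
  by move: lI; rewrite !inE => /orP[->//|->]; rewrite !orbT.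
have [||V0|->] := dI i.2 j.2 _ _ hij s; rewrite ?inE ?eqxx ?orbT//.
  by rewrite V0 eqxx in Vi.
by rewrite mulr0 addr0.
Qed.

End disjoint_sums.

(** * Norms of combinations of atoms *)

Section atoms.
Context {R : realType} {D : choiceType}.
Variable p : R.
Hypothesis p1 : 1 < p.
Let p0 : 0 < p. Proof. exact: lt_trans p1. Qed.
Implicit Types (s : D) (n k : nat) (z Q : R) (I : seq (R * (D * nat))).

Definition dyadic_weight (sn : D * nat) : {posnum R} := (2^-1 ^+ sn.2.+1)%:pos.

(** The unit vector at [sn] for the weight [dyadic_weight]. *)
Definition atom (sn : D * nat) : D * nat -> R :=
  fun t => (2 ^+ sn.2.+1) `^ p^-1 * (t == sn)%:R.

(** [weak_le] for a combination of distinct atoms, written as a finite sum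
    ([weak_le_atoms]), so that norms in [F] become finite computations. *)
Definition atoms_le I Q := forall z, 0 < z ->
  \sum_(i <- I | z < `|i.1| `^ p * 2 ^+ i.2.2.+1) 2^-1 ^+ i.2.2.+1 <= Q / z.

Lemma powRVK (a : R) : 0 <= a -> (a `^ p^-1) `^ p = a.
Proof. by move=> a0; rewrite -powRrM mulVf ?powRr1// gt_eqF. Qed.

Lemma weak_le_atoms I Q : uniq [seq i.2 | i <- I] ->
  weak_le p dyadic_weight (lin_comb atom I) Q <-> atoms_le I Q.
Proof.
move=> uI.
suff E z : 0 < z -> wmass dyadic_weight (level p (lin_comb atom I) z) =
    (\sum_(i <- I | z < `|i.1| `^ p * 2 ^+ i.2.2.+1) 2^-1 ^+ i.2.2.+1)%:E.
  by split=> H z z0; have := H z z0; rewrite E// lee_fin.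
move=> z0; rewrite (@wmass_level_lin_comb _ _ _ _ p0 _ _ id)//; last first.
  move=> k l _ _ kl s; rewrite /atom; have [->|_] := eqVneq s k.
    by right; rewrite (negPf kl) mulr0.
  by left; rewrite mulr0.
rewrite -sumEFin [RHS]big_mkcond; apply: eq_bigr => -[a sn] _ /=.
have E : `|a * (2 ^+ sn.2.+1) `^ p^-1| `^ p = `|a| `^ p * 2 ^+ sn.2.+1.
  by rewrite normrM powRM// [X in _ * X `^ _]ger0_norm ?powR_ge0// powRVK// exprn_ge0.
case: ifPn => az.
  rewrite (_ : level _ _ _ = [set sn]) ?wmass_set1//.
  rewrite /level; apply/seteqP; split=> t /=; last first.
    by move=> ->; rewrite /atom eqxx mulr1 E.
  rewrite /atom; case: eqP => // _; rewrite !mulr0 normr0 powR0 ?gt_eqF//.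
  by rewrite ltNge ltW.
rewrite (_ : level _ _ _ = set0); first by rewrite /wmass esum_set0.
rewrite /level; apply/seteqP; split=> t //=.
rewrite /atom; case: eqP => [_|_]; first by rewrite mulr1 E (negPf az).
by rewrite !mulr0 normr0 powR0 ?gt_eqF// ltNge ltW.
Qed.

(** The terms form part of a geometric series whose largest term is below [1 / z].
    The induction needs the stronger bound that leaves room for the tail. *)
Lemma dyadic_tail (ks : seq nat) z : 0 < z -> uniq ks ->
  \sum_(k <- ks | z < 2 ^+ k) 2^-1 ^+ k <= 2 / z.
Proof.
move=> z0 uks; suff H K (l : seq nat) : uniq l -> all (fun k => k < K)%N l ->
    \sum_(k <- l | z < 2 ^+ k) 2^-1 ^+ k = 0 :> R \/
    \sum_(k <- l | z < 2 ^+ k) 2^-1 ^+ k + 2 * 2^-1 ^+ K <= 2 / z :> R.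
  have /(H _ ks uks)[->|] : all (fun k => k < (\max_(k <- ks) k).+1)%N ks.
  - by apply/allP => k kks; rewrite ltnS; exact: leq_bigmax_seq.
  - by rewrite divr_ge0// ltW.
  - by apply: le_trans; rewrite lerDl mulr_ge0// exprn_ge0.
elim: K l => [|K IH] l ul lK /=.
  by left; case: l lK {ul} => // _; rewrite big_nil.
have h0 : 0 < 2^-1 ^+ K :> R by rewrite exprn_gt0.
have -> : 2 * 2^-1 ^+ K.+1 = 2^-1 ^+ K :> R by rewrite exprS mulrA mulfV// mul1r.
have [Kl|Kl] := boolP (K \in l); last first.
  have [|->|H] := IH l ul; [|by left|right; lra].
  apply/allP => k kl; rewrite ltn_neqAle -ltnS (allP lK k kl) andbT.
  by apply: contraNneq Kl => <-.
have lK' : all (fun k => k < K)%N (rem K l).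
  apply/allP => k; rewrite (mem_rem_uniq _ ul) inE => /andP[kK kl].
  by rewrite ltn_neqAle kK -ltnS (allP lK k kl).
rewrite (perm_big _ (perm_to_rem Kl)) big_cons /=.
have := IH _ (rem_uniq K ul) lK'; set S := \sum_(k <- _ | _) _.
case: ifPn => zK [H|H]; [right|right; lra|by left|right; lra].
have : 2^-1 ^+ K <= 1 / z.
  rewrite ler_pdivlMr// -[leRHS](_ : 2^-1 ^+ K * 2 ^+ K = _); last first.
    by rewrite -exprMn mulVf ?expr1n.
  by rewrite ler_pM2l// ltW.
by rewrite H; lra.
Qed.

End atoms.

Section atom_estimates.
Context {R : realType} {D : choiceType}.
Variable p : R.
Hypothesis p1 : 1 < p.
Let p0 : 0 < p. Proof. exact: lt_trans p1. Qed.
Implicit Types (s : D) (n k : nat) (z Q : R) (I : seq (R * (D * nat))).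

Let norm_le1_powR (a : R) : `|a| <= 1 -> `|a| `^ p <= 1.
Proof.
move=> a1; have <- : 1 `^ p = 1 by rewrite powR1.
by apply: ge0_ler_powR; rewrite ?nnegrE// ltW.
Qed.

(** The weights along a row decrease geometrically, so a row spans a copy of the
    bounded sequences. *)
Lemma atoms_le_row (ns : seq nat) (e : nat -> R) s : uniq ns ->
  (forall n, `|e n| <= 1) -> atoms_le p [seq (e n, (s, n)) | n <- ns] 2.
Proof.
move=> uns e1 z z0; rewrite big_map /=.
have z20 : 0 < z / 2 by rewrite divr_gt0.
apply: (@le_trans _ _ (\sum_(n <- ns | z / 2 < 2 ^+ n) 2^-1 ^+ n.+1)).
  rewrite big_mkcond [leRHS]big_mkcond; apply: ler_sum => n _.
  case: ifPn => [zn|_]; last by case: ifP => // _; rewrite exprn_ge0.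
  rewrite ifT// ltr_pdivrMr// -exprSr; apply: lt_le_trans zn _.
  by rewrite -[leRHS]mul1r ler_pM2r ?exprn_gt0// norm_le1_powR.
under eq_bigr do rewrite exprS.
rewrite -mulr_sumr; apply: le_trans (_ : 2^-1 * (2 / (z / 2)) <= _).
  by rewrite ler_pM2l// dyadic_tail.
by rewrite mulrA mulVf// mul1r invf_div.
Qed.

(** A column spans a copy of the weak [l^p] space with constant weight. *)
Lemma atoms_le_column (ss : seq D) (e : D -> R) n :
  (forall s, `|e s| <= 1) ->
  atoms_le p [seq (e s, (s, n)) | s <- ss] (size ss)%:R.
Proof.
move=> e1 z z0; rewrite big_map /= big_mkcond.
apply: (@le_trans _ _ (\sum_(s <- ss) 1 / z)); last first.
  by rewrite big_const_seq count_predT iter_addr_0 mul1r -[leLHS]mulr_natl.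
apply: ler_sum => s _; case: ifPn => [zn|_]; last by rewrite divr_ge0// ltW.
rewrite ler_pdivlMr// -[leRHS](_ : 2^-1 ^+ n.+1 * 2 ^+ n.+1 = _); last first.
  by rewrite -exprMn mulVf ?expr1n.
rewrite ler_pM2l ?exprn_gt0//; apply: ltW; apply: lt_le_trans zn _.
by rewrite -[leRHS]mul1r ler_pM2r ?exprn_gt0// norm_le1_powR.
Qed.

Lemma big_flatten_nseq (T U : Type) (r : seq T) (m : T -> nat) (f : T -> U)
    (F : U -> R) :
  \sum_(x <- flatten [seq nseq (m y) (f y) | y <- r]) F x =
  \sum_(y <- r) F (f y) *+ m y.
Proof.
rewrite big_flatten big_map; apply: eq_bigr => y _.
by rewrite big_nseq iter_addr_0.
Qed.

(** Stacking the factors [2^(k/p)] over [2^(K-k)] indices each, for many [k],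
    costs no more than a factor [2]: this is the typical element of weak [l^p]
    that is far from [l^p]. *)
Lemma atoms_le_levels (ks : seq nat) K n I : uniq ks ->
  (forall k, k \in ks -> k <= K)%N ->
  [seq (i.1, i.2.2) | i <- I] =
    flatten [seq nseq (2 ^ (K - k)) ((2 ^+ k) `^ p^-1, n) | k <- ks] ->
  atoms_le p I (2 ^+ K.+1).
Proof.
move=> uks kK IE z z0; rewrite big_mkcond.
pose F (j : R * nat) : R :=
  if z < `|j.1| `^ p * 2 ^+ j.2.+1 then 2^-1 ^+ j.2.+1 else 0.
rewrite -(big_map (fun i => (i.1, i.2.2)) predT F) IE big_flatten_nseq.
rewrite /F /=; set h : R := 2 ^+ n.+1; have h0 : 0 < h by rewrite exprn_gt0.
have zh0 : 0 < z / h by rewrite divr_gt0.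
apply: (@le_trans _ _ (\sum_(k <- ks | z / h < 2 ^+ k) h^-1 * 2 ^+ K * 2^-1 ^+ k)).
  rewrite [leRHS]big_mkcond big_seq [leRHS]big_seq; apply: ler_sum => k kks.
  rewrite ger0_norm ?powR_ge0// powRVK// ?exprn_ge0// ltr_pdivrMr//.
  case: ifP => _; last by rewrite mul0rn.
  have E : (2 ^ (K - k))%:R = 2 ^+ K * 2^-1 ^+ k :> R.
    rewrite natrX -{2}(subnK (kK _ kks)) exprD -mulrA -exprMn mulfV//.
    by rewrite expr1n mulr1.
  by rewrite exprVn -/h -[leLHS]mulr_natr E mulrA.
rewrite -mulr_sumr; apply: (@le_trans _ _ (h^-1 * 2 ^+ K * (2 / (z / h)))).
  by rewrite ler_pM2l ?dyadic_tail// mulr_gt0 ?invr_gt0 ?exprn_gt0.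
rewrite invf_div exprS le_eqVlt; apply/orP; left; apply/eqP.
rewrite [2 * (h / z)]mulrCA mulrACA mulrA mulVf ?gt_eqF// mul1r.
by rewrite mulrA [2 * _]mulrC.
Qed.

(** No row is used twice, so that the terms of the image of the combination are
    disjointly supported as soon as different rows are. *)
Lemma distinct_keys (A : set D) (J : seq (R * nat)) : infinite_set A ->
  exists I, [/\ [seq (i.1, i.2.2) | i <- I] = J,
    uniq [seq i.2.1 | i <- I] & forall s, s \in [seq i.2.1 | i <- I] -> A s].
Proof.
move=> /(infinite_set_seq (size J))[G [uG sG GA]].
pose I := [seq (j.2.1, (j.1, j.2.2)) | j <- zip G J]; exists I.
have -> : [seq i.2.1 | i <- I] = G.
  rewrite -[RHS](@unzip1_zip _ _ G J) ?sG// -map_comp.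
  by apply: eq_map => -[].
split=> //; rewrite -[RHS](@unzip2_zip _ _ G J) ?sG// -map_comp.
by apply: eq_map => -[s []].
Qed.

End atom_estimates.

Lemma unbounded_infinite (P : set nat) :
  (forall m, exists n, (m <= n)%N /\ P n) -> infinite_set P.
Proof.
move=> PP /finite_seqP[G PG]; have [n [/= mn]] := PP (\max_(k <- G) k).+1.
rewrite PG /= => nG; move: mn; rewrite ltnNge => /negP; apply.
exact: leq_bigmax_seq.
Qed.

(** * Bounded functionals on the span of the atoms *)

Section bounded_functional.
Context {R : realType} {D : choiceType}.
Variables (p : R) (A : set D) (l : D * nat -> R) (C : R).
Hypothesis p1 : 1 < p.
Hypothesis C0 : 0 < C.
Hypothesis lC : forall (I : seq (R * (D * nat))) Q, 0 < Q ->
  uniq [seq i.2 | i <- I] -> (forall i, i \in I -> A i.2.1) ->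
  atoms_le p I Q -> `|\sum_(i <- I) i.1 * l i.2| `^ p <= C * Q.
Let p0 : 0 < p. Proof. exact: lt_trans p1. Qed.

Let sum_sg (T : Type) (r : seq T) (f : T -> R) c : 0 <= c ->
  all (fun x => c < `|f x|) r ->
  ((size r)%:R * c) `^ p <= `|\sum_(x <- r) Num.sg (f x) * f x| `^ p.
Proof.
move=> c0 rc; apply: ge0_ler_powR; rewrite ?nnegrE ?mulr_ge0 ?(ltW p0)//.
rewrite (eq_bigr (fun x => `|f x|)); last by move=> x _; rewrite -normrEsg.
rewrite ger0_norm ?sumr_ge0//; elim: r rc => [|x r IH /= /andP[xc /IH rc]].
  by rewrite big_nil mul0r.
by rewrite big_cons -natr1 mulrDl mul1r addrC lerD// ltW.
Qed.

Let sg_le1 (a : R) : `|Num.sg a| <= 1.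
Proof. by rewrite normr_sg; case: (a == 0). Qed.

(** If the functional exceeds [c] at [J] rows of column [n], the sum of the
    corresponding atoms with suitable signs yields [J * c <= (C * J)^(1/p)], which
    bounds [J] since [1 < p]. *)
Lemma countable_coord n : countable [set s | A s /\ l (s, n) != 0].
Proof.
rewrite (_ : mkset _ = \bigcup_j [set s | A s /\ j.+1%:R^-1 < `|l (s, n)|]); last first.
  apply/seteqP; split=> s /=; last first.
    by move=> [j _ [As]] lj; split=> //; rewrite -normr_gt0; apply: lt_trans lj.
  move=> [As]; rewrite -normr_gt0 => l0; exists (Num.truncn (`|l (s, n)|^-1)) => //.
  split=> //; rewrite -[X in _ < X]invrK ltf_pV2 ?posrE ?invr_gt0//.
  by rewrite truncnS_gt.
apply: bigcup_countable => // j _; apply: finite_set_countable.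
apply: contrapT => /infinite_set_seq Ainf; set c : R := j.+1%:R^-1 in Ainf.
have c0 : 0 < c by rewrite invr_gt0.
have q0 : 0 < p - 1 by rewrite subr_gt0.
pose B := (C / c `^ p) `^ (p - 1)^-1.
have [G [uG sG GA]] := Ainf (Num.truncn B).+1.
pose I := [seq (Num.sg (l (s, n)), (s, n)) | s <- G].
have uI : uniq [seq i.2 | i <- I].
  by rewrite -map_comp map_inj_uniq// => s t [].
have IA i : i \in I -> A i.2.1 by move=> /mapP[s sG' ->] /=; have [] := GA _ sG'.
have G0 : 0 < (size G)%:R :> R by rewrite sG.
have := lC G0 uI IA (atoms_le_column p1 G n (fun s => sg_le1 (l (s, n)))).
rewrite big_map /= => /(le_trans (@sum_sg _ G (fun s => l (s, n)) c (ltW c0) _)).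
have -> : all (fun s => c < `|l (s, n)|) G by apply/allP => s /GA[].
move=> /(_ isT); rewrite powRM// ?(ltW c0)// -mulr_powRB1// -mulrA [leRHS]mulrC.
rewrite ler_pM2l// -ler_pdivlMr ?powR_gt0// leNgt => /negP; apply.
rewrite -[ltLHS](_ : B `^ (p - 1) = _); last first.
  by rewrite /B -powRrM mulVf ?gt_eqF// powRr1// divr_ge0 ?powR_ge0// ltW.
by rewrite gt0_ltr_powR ?nnegrE ?powR_ge0// sG truncnS_gt.
Qed.

(** The same with [J] atoms of one row, whose sum is bounded independently of
    [J]. *)
Lemma coord_cvg0 s c : A s -> 0 < c ->
  exists m, forall n, (m <= n)%N -> `|l (s, n)| <= c.
Proof.
move=> As c0; apply: contrapT => H.
have /infinite_set_seq Ainf : infinite_set [set n | c < `|l (s, n)|].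
  apply: unbounded_infinite => m; apply: contrapT => Hm; apply: H; exists m => n mn.
  by rewrite leNgt; apply/negP => ln; apply: Hm; exists n.
pose B := (C * 2) `^ p^-1 / c.
have [G [uG sG GA]] := Ainf (Num.truncn B).+1.
pose I := [seq (Num.sg (l (s, n)), (s, n)) | n <- G].
have uI : uniq [seq i.2 | i <- I].
  by rewrite -map_comp map_inj_uniq// => m n [].
have IA i : i \in I -> A i.2.1 by move=> /mapP[n sG' ->].
have := lC (ltr0Sn _ _) uI IA (atoms_le_row p1 _ uG (fun n => sg_le1 (l (s, n)))).
rewrite big_map /= => /(le_trans (@sum_sg _ G (fun n => l (s, n)) c (ltW c0) _)).
have -> : all (fun n => c < `|l (s, n)|) G by apply/allP => n /GA.
move=> /(_ isT); rewrite -(powRVK p1 (_ : 0 <= C * 2)) ?mulr_ge0 ?(ltW C0)//.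
rewrite leNgt => /negP; apply; apply: gt0_ltr_powR; rewrite ?nnegrE ?powR_ge0//.
  by rewrite mulr_ge0// ltW.
by rewrite -ltr_pdivrMr// sG truncnS_gt.
Qed.

End bounded_functional.

(** * Uncountably many rows do not embed *)

Section cardinality_tools.

Lemma uncountable_pigeonhole (T : Type) (K : countType) (A : set T)
    (F : K -> set T) :
  ~ countable A -> A `<=` \bigcup_i F i -> exists i, ~ countable (F i).
Proof.
move=> nA AF; apply: contrapT => H; apply: nA.
apply: sub_countable (subset_card_le AF) _; apply: bigcup_countable => // i _.
by apply: contrapT => nF; apply: H; exists i.
Qed.

Lemma uncountable_infinite (T : Type) (A : set T) : ~ countable A -> infinite_set A.
Proof. by move=> nA; apply: contra_not nA; exact: finite_set_countable. Qed.

Lemma countable_setU (T : Type) (A B : set T) :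
  countable A -> countable B -> countable (A `|` B).
Proof.
move=> cA cB; apply: contrapT => /(@uncountable_pigeonhole _ bool _
  (fun b => if b then A else B))[|[]] //.
by move=> x [Ax|Bx]; [exists true|exists false].
Qed.

End cardinality_tools.

Section no_embedding.
Context {R : realType} {D G : choiceType}.
Variables (p : R) (u : D * nat -> G -> R) (A : set D) (C : R).
Hypothesis p1 : 1 < p.
Hypothesis C0 : 0 < C.
Implicit Types (I : seq (R * (D * nat))) (Q z c e : R) (s : D) (n : nat) (g : G).

Local Notation mass := (wmass (R := R) (S := G) unit_weight).

(* Together, uC and Cu say that u transports the norm of F on the rows in A to the
   weak norm on G, up to the constant C. *)
Hypothesis uC : forall I Q, 0 < Q -> uniq [seq i.2 | i <- I] ->
  (forall i, i \in I -> A i.2.1) ->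
  atoms_le p I Q -> weak_le p unit_weight (lin_comb u I) (C * Q).
Hypothesis Cu : forall I Q, 0 < Q -> uniq [seq i.2 | i <- I] ->
  (forall i, i \in I -> A i.2.1) ->
  weak_le p unit_weight (lin_comb u I) Q -> atoms_le p I (C * Q).

Let p0 : 0 < p. Proof. exact: lt_trans p1. Qed.

Let u_functional g I Q : 0 < Q -> uniq [seq i.2 | i <- I] ->
  (forall i, i \in I -> A i.2.1) ->
  atoms_le p I Q -> `|\sum_(i <- I) i.1 * u i.2 g| `^ p <= C * Q.
Proof.
move=> Q0 uI IA IQ; have := weak_le_coord g (mulr_gt0 C0 Q0) (uC Q0 uI IA IQ).
by rewrite mulr1.
Qed.

Let u_le s n : A s -> weak_le p unit_weight (u (s, n)) C.
Proof.
move=> As; have I1 := @atoms_le_column _ _ _ p1 [:: s] (fun=> 1) n.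
have := uC ltr01 _ _ (I1 _); rewrite mulr1.
have -> : lin_comb u [seq (1, (s, n)) | s <- [:: s]] = u (s, n).
  by apply/funext => g; rewrite /lin_comb big_cons big_nil addr0 mul1r.
apply=> //; first by move=> i; rewrite inE => /eqP ->.
by move=> _; rewrite normr1.
Qed.

Let weak_le_finite (x : G -> R) Q z : weak_le p unit_weight x Q -> 0 < z ->
  finite_set (level p x z).
Proof.
move=> xQ z0; apply: finite_mass_finite_set; apply: le_lt_trans (xQ _ z0) _.
exact: ltry.
Qed.

Definition joint_support s : set G := [set g | exists n, u (s, n) g != 0].

Let countable_joint_support s : A s -> countable (joint_support s).
Proof.
move=> As.
rewrite (_ : joint_support s =
    \bigcup_n \bigcup_j level p (u (s, n)) (j.+1%:R^-1)); last first.
  apply/seteqP; split=> [g [n un]|g [n _ [j _ gj]]].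
    have u0 : 0 < `|u (s, n) g| `^ p by rewrite powR_gt0// normr_gt0.
    exists n => //; exists (Num.truncn ((`|u (s, n) g| `^ p)^-1)) => //.
    rewrite /level/= -[X in _ < X]invrK ltf_pV2 ?posrE ?invr_gt0//.
    by rewrite truncnS_gt.
  exists n; apply: contraTneq gj => un; rewrite un normr0 powR0 ?gt_eqF//.
  by rewrite -leNgt.
apply: bigcup_countable => // n _; apply: bigcup_countable => // j _.
by apply: finite_set_countable; apply: weak_le_finite (u_le n As) _.
Qed.

(** If a maximal subset with disjoint supports were countable, so would be the
    union of these supports, and only countably many rows meet it. *)
Lemma uncountable_disjoint_supports : ~ countable A ->
  exists B, [/\ B `<=` A, ~ countable B & trivIset B joint_support].
Proof.
move=> nA; have [B [BA dB maxB]] := ex_maximal_disjoint_subcollection joint_support A.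
exists B; split=> // cB; apply: nA.
apply: (@sub_countable _ _ _ (B `|` \bigcup_(t in B) \bigcup_(g in joint_support t)
    \bigcup_n [set s | A s /\ u (s, n) g != 0])).
  apply: subset_card_le => s As; have [Bs|nBs] := pselect (B s); [by left|right].
  apply: contrapT => H; apply: (maxB (B `|` [set s])).
  - by split=> [|BB]; [exact: subsetUl|apply: nBs; apply: BB; right].
  - by move=> t [/BA//|->].
  - move=> a b [Ba|->] [Bb|->] // [g [ga gb]].
    + by apply: dB => //; exists g.
    + by exfalso; apply: H; exists a => //; exists g => //; case: gb => n un; exists n.
    + by exfalso; apply: H; exists b => //; exists g => //; case: ga => n un; exists n.
apply: countable_setU => //; apply: bigcup_countable => // t /BA At.
apply: bigcup_countable => [|g _]; first exact: countable_joint_support.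
apply: bigcup_countable => // n _.
exact: (@countable_coord _ _ p A (fun sn => u sn g) C p1 C0 (u_functional g)).
Qed.

Let finite_eventually (T : eqType) (r : seq T) (P : T -> nat -> Prop) :
  (forall x, x \in r -> exists m, forall n, (m <= n)%N -> P x n) ->
  exists m, forall n x, (m <= n)%N -> x \in r -> P x n.
Proof.
elim: r => [|x r IH] H; first by exists 0%N.
have [m Hm] := H x (mem_head _ _).
have [m' Hm'] := IH (fun y yr => H y (mem_behead (yr : y \in behead (x :: r)))).
exists (maxn m m') => n y; rewrite geq_max => /andP[mn m'n]; rewrite inE.
by move=> /orP[/eqP ->|yr]; [exact: Hm|exact: Hm'].
Qed.

Let lt_normD (a b c : R) : `|b| < `|a| - c -> c < `|a + b|.
Proof.
by move=> ab; apply: lt_le_trans (lerB_normD _ _); rewrite ltrBrDr addrC -ltrBrDr.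
Qed.

(** Gliding hump: if [u (s, n)] exceeded [c] somewhere for arbitrarily large [n],
    one could build sums of distinct [u (s, n)] that exceed [c / 2] at arbitrarily
    many points. As [u (s, n)] tends to [0] at each point, a late term barely
    disturbs the points already won, and its peak lies away from the finite set
    where the current sum is at least [c / 2]. Sums over a row are bounded. *)
Lemma sup_norm_cvg0 s c : A s -> 0 < c ->
  exists m, forall n g, (m <= n)%N -> `|u (s, n) g| <= c.
Proof.
move=> As c0; apply: contrapT => H.
have u0 g (d : R) : 0 < d -> exists m, forall n, (m <= n)%N -> `|u (s, n) g| <= d.
  exact: (@coord_cvg0 _ _ p A (fun sn => u sn g) C p1 C0 (u_functional g)).
pose x (ns : seq nat) : G -> R := fun g => \sum_(n <- ns) u (s, n) g.
have x_le ns : uniq ns -> weak_le p unit_weight (x ns) (C * 2).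
  move=> uns; have I1 := @atoms_le_row _ _ _ p1 ns (fun=> 1) s uns.
  have := uC (ltr0Sn _ 1) _ _ (I1 _).
  have -> : lin_comb u [seq (1, (s, n)) | n <- ns] = x ns.
    by apply/funext => g; rewrite /lin_comb big_map; under eq_bigr do rewrite mul1r.
  apply=> //; last by move=> _; rewrite normr1.
    by rewrite -map_comp map_inj_uniq// => m n [].
  by move=> i /mapP[n _ ->].
have [J HJ] : exists J, C * 2 / (c / 2) `^ p < J%:R.
  by exists (Num.truncn (C * 2 / (c / 2) `^ p)).+1; rewrite truncnS_gt.
have c20 : 0 < c / 2 by rewrite divr_gt0.
suff [ns [gs [uns ugs sgs gsc]]] : exists ns gs, [/\ uniq ns, uniq gs, size gs = J &
    forall g, g \in gs -> c / 2 < `|x ns g|].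
  have /(size_le_mass (R := R) ugs) : [set` gs] `<=` level p (x ns) ((c / 2) `^ p).
    move=> g /gsc gc; rewrite /level/=.
    by apply: gt0_ltr_powR; rewrite ?nnegrE// ltW.
  move=> /le_trans/(_ (x_le _ uns _ (powR_gt0 _ c20))); rewrite lee_fin sgs.
  by rewrite leNgt HJ.
elim: J {HJ} => [|J [ns [gs [uns ugs sgs gsc]]]]; first by exists [::], [::].
have c40 : 0 < c / 4 by rewrite divr_gt0.
have /finite_seqP[hs Hhs] := weak_le_finite (x_le _ uns) (powR_gt0 p c40).
have xhs g : c / 2 <= `|x ns g| -> g \in hs.
  move=> xg; have : level p (x ns) ((c / 4) `^ p) g; last by rewrite Hhs.
  rewrite /level/=; apply: gt0_ltr_powR; rewrite ?nnegrE ?(ltW c40)//.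
  by apply: lt_le_trans xg; rewrite ltr_pM2l// ltf_pV2 ?posrE// ltr_nat.
(* Half of the margin by which the sum exceeds c / 2 at each point already won. *)
have [m1 H1] := @finite_eventually _ gs (fun g n => `|u (s, n) g| <= (`|x ns g| - c / 2) / 2)
  (fun g gg => u0 g _ (divr_gt0 (etrans (subr_gt0 _ _) (gsc g gg)) (ltr0Sn _ 1))).
have [m2 H2] := @finite_eventually _ hs (fun g n => `|u (s, n) g| <= c)
  (fun g _ => u0 g _ c0).
have [m3 H3] : exists m, forall n, (m <= n)%N -> n \notin ns.
  exists (\max_(k <- ns) k).+1 => n mn; apply/negP => nns.
  by move: mn; rewrite ltnNge => /negP; apply; exact: leq_bigmax_seq.
have [n [g [nm ung]]] : exists n g, (maxn m1 (maxn m2 m3) <= n)%N /\ c < `|u (s, n) g|.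
  apply: contrapT => H'; apply: H; exists (maxn m1 (maxn m2 m3)) => n g mn.
  by rewrite leNgt; apply/negP => ung; apply: H'; exists n, g.
move: nm; rewrite !geq_max => /and3P[nm1 nm2 nm3].
have ghs : g \notin hs by apply/negP => /(H2 n g nm2); rewrite leNgt ung.
have xg : `|x ns g| < c / 2 by rewrite ltNge; apply: contra ghs; exact: xhs.
exists (n :: ns), (g :: gs); split=> /=.
- by rewrite H3.
- by rewrite ugs andbT; apply: contra ghs => /gsc/ltW; exact: xhs.
- by rewrite sgs.
- have E h : x (n :: ns) h = u (s, n) h + x ns h by rewrite /x big_cons.
  move=> h; rewrite inE E => /orP[/eqP ->|hgs].
    by apply: lt_normD; apply: lt_trans xg _; rewrite ltrBrDr -splitr.
  rewrite addrC; apply: lt_normD; apply: le_lt_trans (H1 n h nm1 hgs) _.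
  by rewrite /= ltr_pdivrMr// ltr_pMr ?ltr1n// subr_gt0 gsc.
Qed.

Lemma level_scale (a : R) (x : G -> R) z : a != 0 ->
  level p (fun g => a * x g) z = level p x (z / `|a| `^ p).
Proof.
move=> a0; apply/funext => g; apply/propext; rewrite /level/= ltr_pdivrMr; last first.
  by rewrite powR_gt0// normr_gt0.
by rewrite mulrC -powRM// -normrM.
Qed.

(* Rounding a bad height down to a power of 1/2 halves the constant at worst. *)
Let bad_levels s n e : 0 < e ->
  ~ (exists2 t : R, 0 < t & forall z, 0 < z -> z < t ->
      (mass (level p (u (s, n)) z) <= (e / z)%:E)%E) ->
  infinite_set [set k | ((e / 2 * 2 ^+ k)%:E <
    mass (level p (u (s, n)) (2^-1 ^+ k)))%E].
Proof.
move=> e0 H; apply: unbounded_infinite => m; apply: contrapT => Hm; apply: H.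
exists (2^-1 ^+ m); first by rewrite exprn_gt0.
move=> z z0 zm; rewrite leNgt; apply/negP => ez; apply: Hm.
have h0 k : 0 < 2^-1 ^+ k :> R by rewrite exprn_gt0.
have ex : exists k, 2^-1 ^+ k <= z.
  exists (Num.truncn z^-1).+1; rewrite exprVn invf_ple ?posrE// ?exprn_gt0//.
  apply: ltW; apply: lt_le_trans (truncnS_gt _) _.
  by rewrite -natrX ler_nat ltnW// ltn_expl.
case: (ex_minnP ex) => k kz kmin.
have mk : (m < k)%N.
  rewrite ltnNge; apply/negP => km; move: zm; rewrite ltNge => /negP; apply.
  by apply: le_trans kz; apply: ler_wiXn2l; rewrite ?invr_ge0// invf_le1 ?ler1n.
exists k; split; first exact: ltnW.
have zk : z < 2 * 2^-1 ^+ k.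
  case: k mk kz kmin => // k _ kz kmin; rewrite ltNge; apply/negP.
  by rewrite exprS mulrA mulfV// mul1r => /kmin; rewrite ltnn.
apply: lt_le_trans (_ : ((e / z)%:E <= _)%E).
  rewrite lte_fin -mulrA ltr_pM2l// -[ltRHS]div1r ltr_pdivlMr//.
  rewrite -ltr_pdivlMl ?mulr_gt0 ?invr_gt0 ?exprn_gt0// mulr1.
  by rewrite invfM invrK -exprVn.
apply: le_trans (ltW ez) _; apply: le_wmass => g; rewrite /level/=.
exact: le_lt_trans.
Qed.

Let wmass_level_lin_combu (B : set D) I z : 0 < z -> uniq [seq i.2.1 | i <- I] ->
  (forall i, i \in I -> B i.2.1) -> trivIset B joint_support ->
  mass (level p (lin_comb u I) z) =
  (\sum_(i <- I) mass (level p (fun g => (i.1 * u i.2 g)%R) z))%E.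
Proof.
move=> z0 uI IB dB.
have B1 (k : D * nat) : k.1 \in [seq i.2.1 | i <- I] -> B k.1.
  by move=> /mapP[i iI ->]; exact: IB.
apply: (@wmass_level_lin_comb _ _ _ _ p0 _ _ fst) => //= -[s n] [t m].
move=> /B1 Bs /B1 Bt /= /eqP st g; apply: contrapT => /not_orP[/eqP us /eqP ut].
by apply: st; apply: dB => //; exists g; split; [exists n|exists m].
Qed.

(** The levels of a bad row form an infinite set of integers, and there are
    countably many finite sets of integers, so uncountably many bad rows share [L]
    bad levels; [atoms_le_levels] aligns these at height [1]. *)
Lemma countable_fat_tails B n e : B `<=` A -> trivIset B joint_support -> 0 < e ->
  countable [set s | B s /\
    ~ (exists2 t : R, 0 < t & forall z, 0 < z -> z < t ->
      (mass (level p (u (s, n)) z) <= (e / z)%:E)%E)].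
Proof.
move=> BA dB e0; apply: contrapT => bad.
pose fat s k := ((e / 2 * 2 ^+ k)%:E < mass (level p (u (s, n)) (2^-1 ^+ k)))%E.
pose L := (Num.truncn (4 * C / e)).+1.
pose B_ (ks : seq nat) := [set s | [/\ B s, uniq ks, size ks = L &
  forall k, k \in ks -> fat s k]].
have [|ks] := @uncountable_pigeonhole _ _ _ B_ bad.
  move=> s [Bs /(bad_levels e0)/(infinite_set_seq L)[ks [uks sks ksP]]].
  by exists ks.
set B' := B_ ks => B'unc; have B'inf := uncountable_infinite B'unc.
have [s0 [_ uks sks _]] := infinite_setN0 B'inf.
pose K := (\max_(k <- ks) k)%N.
have kK k : (k \in ks -> k <= K)%N by move=> kks; exact: leq_bigmax_seq.
pose J := flatten [seq nseq (2 ^ (K - k)) ((2 ^+ k) `^ p^-1, n) | k <- ks].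
have [I [IJ uI IB]] := distinct_keys J B'inf.
have uI2 : uniq [seq i.2 | i <- I].
  by apply: (@map_uniq _ _ fst); rewrite -map_comp.
have IA i : i \in I -> B' i.2.1 by move=> iI; apply: IB; exact: map_f.
have /(_ 1 ltr01) := uC (exprn_gt0 _ (ltr0Sn _ 1)) uI2
  (fun i iI => BA _ (let: And4 Bi _ _ _ := IA i iI in Bi))
  (atoms_le_levels p1 uks kK IJ).
rewrite divr1 (wmass_level_lin_combu _ _ _ dB)//; last first.
  by move=> i iI; have [] := IA i iI.
apply/negP; rewrite -ltNge.
pose F (j : R * nat) : R := e / 2 * `|j.1| `^ p.
apply: (@lt_le_trans _ _ (\sum_(i <- I) F (i.1, i.2.2))%:E); last first.
  rewrite -sumEFin big_seq [leRHS]big_seq; apply: lee_sum => i iI.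
  have [_ _ _ fatk] := IA i iI.
  have : (i.1, i.2.2) \in J by rewrite -IJ; apply/mapP; exists i.
  case: i {iI} fatk => a [s n'] /= fatk.
  move=> /flatten_mapP[k kks]; rewrite mem_nseq => /andP[_ /eqP[-> ->]].
  rewrite /F /= level_scale ?gt_eqF ?powR_gt0 ?exprn_gt0// ger0_norm ?powR_ge0//.
  by rewrite powRVK ?exprn_ge0// div1r -exprVn ltW//; exact: fatk.
rewrite -(big_map (fun i => (i.1, i.2.2)) predT F) IJ big_flatten_nseq lte_fin.
rewrite big_seq (eq_bigr (fun=> e / 2 * 2 ^+ K)); last first.
  move=> k kks; rewrite /F /= ger0_norm ?powR_ge0// powRVK ?exprn_ge0//.
  by rewrite -[LHS]mulr_natr natrX -mulrA -exprD subnKC ?kK.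
rewrite -big_seq big_const_seq count_predT iter_addr_0 sks -[ltRHS]mulr_natl.
rewrite exprS !mulrA ltr_pM2r ?exprn_gt0// -!ltr_pdivrMr ?invr_gt0//.
rewrite [ltLHS](_ : _ = 4 * C / e) ?truncnS_gt//.
by field; rewrite gt_eqF.
Qed.

Let thin s n e t := forall z, 0 < z -> z < t ->
  (mass (level p (u (s, n)) z) <= (e / z)%:E)%E.

Let later (B : set D) (x y : nat * R) :=
  `[< (y.1 < x.1)%N /\ forall s g, B s -> `|u (s, x.1) g| `^ p <= y.2 >].

(** The list is built from its head: each new column is taken far enough for its
    sup norm to lie below all previous thresholds, and then gets its own threshold,
    below which its tail is thin. Column and threshold range over countable sets,
    so uncountably many rows agree on them. *)
Lemma separated_scales B e N : B `<=` A -> ~ countable B ->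
  trivIset B joint_support -> 0 < e ->
  exists (r : seq (nat * R)) B', [/\ B' `<=` B, ~ countable B', size r = N,
    forall x, x \in r -> 0 < x.2 /\ forall s, B' s -> thin s x.1 e x.2 &
    pairwise (later B') r].
Proof.
move=> BA nB dB e0; elim: N => [|N [r [B1 [B1B nB1 sr thinr later_r]]]].
  by exists [::], B; split.
have [T T0 rT] : exists2 T : R, 0 < T & forall x, x \in r -> T <= x.2.
  elim: r thinr {sr later_r} => [|x r IH] thinr; first by exists 1.
  have [y yr|T T0 TP] := IH; first by apply: thinr; rewrite inE yr orbT.
  have [x0 _] := thinr x (mem_head _ _).
  exists (Num.min T x.2); first by rewrite lt_min T0 x0.
  move=> y; rewrite inE ge_min => /orP[/eqP ->|/TP ->//]; first by rewrite lexx orbT.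
pose m := (\max_(x <- r) x.1).+1.
pose B2_ n := [set s | [/\ B1 s, (m <= n)%N & forall g, `|u (s, n) g| `^ p <= T]].
have [|n nB2] := @uncountable_pigeonhole _ _ _ B2_ nB1.
  move=> s B1s; have T'0 : 0 < T `^ p^-1 by rewrite powR_gt0.
  have [m' Hm'] := sup_norm_cvg0 (BA _ (B1B _ B1s)) T'0.
  exists (maxn m m') => //; split=> //; first exact: leq_maxl.
  move=> g; rewrite -(powRVK p1 (ltW T0)); apply: ge0_ler_powR.
  - exact: ltW.
  - by rewrite nnegrE.
  - by rewrite nnegrE powR_ge0.
  - by apply: Hm'; exact: leq_maxr.
pose fat := [set s | B s /\ ~ exists2 t : R, 0 < t & thin s n e t].
(* None collects the rows without threshold; Some j those with threshold 1/(j+1). *)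
pose B3_ (o : option nat) :=
  if o is Some j then [set s | B2_ n s /\ thin s n e j.+1%:R^-1] else fat.
have [|[j|]] := @uncountable_pigeonhole _ _ _ B3_ nB2; last 2 first.
- move=> nB3; exists ((n, j.+1%:R^-1) :: r), (B3_ (Some j)); split=> //=.
  + by move=> s [[/B1B]].
  + by rewrite sr.
  + move=> x; rewrite inE => /orP[/eqP ->/=|xr].
      by rewrite invr_gt0; split=> // s [].
    by have [x0 xthin] := thinr x xr; split=> // s [[B1s _ _] _]; exact: xthin.
  + apply/andP; split.
      apply/allP => y yr; apply/asboolP; split.
        have [s [[_ mn _] _]] := infinite_setN0 (uncountable_infinite nB3).
        by apply: leq_trans mn; rewrite ltnS /m; apply: leq_bigmax_seq.
      by move=> s g [[_ _ uT] _]; apply: le_trans (uT g) (rT y yr).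
    apply: sub_pairwise later_r => x y /asboolP[yx uy]; apply/asboolP; split=> //.
    by move=> s g [[B1s _ _] _]; exact: uy.
- by move=> /(_ (countable_fat_tails n BA dB e0)).
move=> s B2s; have [Bs mn uT] := B2s.
have [[t t0 st]|nt] := pselect (exists2 t : R, 0 < t & thin s n e t); last first.
  by exists None => //; split=> //; exact: B1B.
exists (Some (Num.truncn t^-1)) => //; split=> // z z0 zt; apply: st => //.
apply: lt_trans zt _; rewrite -[ltRHS]invrK ltf_pV2 ?posrE ?invr_gt0//.
by rewrite truncnS_gt.
Qed.

Lemma sum_at_most_one (T : Type) (act : pred T) (a e : R) (r : seq T) :
  0 <= e -> e <= a -> pairwise (fun x y => ~~ (act x && act y)) r ->
  \sum_(x <- r) (if act x then a else e) <= a + (size r)%:R * e.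
Proof.
move=> e0 ea; elim: r => [|x r IH /= /andP[xr rr]].
  by rewrite big_nil mul0r addr0 (le_trans e0).
rewrite big_cons -natr1 mulrDl mul1r /=; case: ifPn xr => ax xr; last first.
  by rewrite addrC addrA lerD2r IH.
rewrite lerD2l; apply: (@le_trans _ _ ((size r)%:R * e)); last by rewrite lerDl.
elim: r xr {IH rr} => [_|y r IH /= /andP[ay /IH]]; first by rewrite big_nil mul0r.
by rewrite big_cons (negPf ay) -natr1 mulrDl mul1r /= addrC lerD2r.
Qed.

(** The test vector has coefficient [2^(-(n+1)/p)] on [2^(n+1)] atoms of each chosen
    column [n], hence equals [1] on its support. *)
Lemma no_uncountable_embedding : countable A.
Proof.
apply: contrapT => /[dup] nA /uncountable_disjoint_supports[B [BA nB dB]].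
(* The final inequality reads N <= 2 C (C + e + N e), and 2 C e = 1/2. *)
pose e := (4 * C)^-1; have e0 : 0 < e by rewrite invr_gt0 mulr_gt0.
pose N := (Num.truncn (4 * C ^+ 2 + 4)).+1.
have [r [B' [B'B nB' sr thinr later_r]]] := separated_scales N BA nB dB e0.
pose J := flatten [seq nseq (2 ^ x.1.+1) ((2^-1 ^+ x.1.+1) `^ p^-1, x.1) | x <- r].
have [I [IJ uI IB]] := distinct_keys J (uncountable_infinite nB').
have uI2 : uniq [seq i.2 | i <- I].
  by apply: (@map_uniq _ _ fst); rewrite -map_comp.
have IB' i : i \in I -> B' i.2.1 by move=> iI; apply: IB; exact: map_f.
have IA i : i \in I -> A i.2.1 by move=> /IB'/B'B/BA.
have h0 k : 0 < 2^-1 ^+ k :> R by rewrite exprn_gt0.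
have hK k : 2^-1 ^+ k * 2 ^+ k = 1 :> R by rewrite -exprMn mulVf ?expr1n.
pose Q := Num.max C e + N%:R * e.
have Q0 : 0 < Q.
  by rewrite ltr_wpDr ?mulr_ge0 ?(ltW e0)// lt_max C0.
have IQ : weak_le p unit_weight (lin_comb u I) Q.
  move=> z z0; rewrite (wmass_level_lin_combu _ _ _ (sub_trivIset B'B dB))//.
  pose t n : R := z * 2 ^+ n.+1.
  have t0 n : 0 < t n by rewrite mulr_gt0// exprn_gt0.
  (* The columns that contribute more than e at the height z. *)
  pose act n := `[< exists2 s, B' s &
    ((e / t n)%:E < mass (level p (u (s, n)) (t n)))%E >].
  pose b n := if act n then Num.max C e else e.
  pose F (j : R * nat) : R := b j.2 / t j.2.
  apply: (@le_trans _ _ (\sum_(i <- I) F (i.1, i.2.2))%:E).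
    rewrite -sumEFin big_seq [leRHS]big_seq; apply: lee_sum => i iI.
    have : (i.1, i.2.2) \in J by rewrite -IJ; apply/mapP; exists i.
    have := IB' i iI; case: i {iI} => a [s n] /= B's.
    move=> /flatten_mapP[x xr]; rewrite mem_nseq => /andP[_ /eqP[-> ->]].
    rewrite level_scale ?gt_eqF ?powR_gt0// ger0_norm ?powR_ge0// powRVK ?(ltW (h0 _))//.
    rewrite exprVn invrK /F /b /= -/(t x.1); case: ifPn => [_|nact].
      apply: le_trans (u_le _ (BA _ (B'B _ B's)) (t0 _)) _.
      by rewrite lee_fin ler_pM2r ?invr_gt0// le_max lexx.
    by rewrite leNgt; apply: contra nact => nact; apply/asboolP; exists s.
  rewrite -(big_map (fun i => (i.1, i.2.2)) predT F) IJ big_flatten_nseq lee_fin.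
  rewrite (eq_bigr (fun x => b x.1 / z)); last first.
    move=> x _; rewrite /F /= /t -[LHS]mulr_natr natrX -mulrA invfM.
    by rewrite -[X in _ * X = _]mulrA mulVf ?mulr1// expf_neq0.
  rewrite -mulr_suml ler_pM2r ?invr_gt0// /Q -sr.
  apply: (@sum_at_most_one _ (fun x => act x.1)); rewrite ?(ltW e0)//.
    by rewrite le_max lexx orbT.
  apply: (@sub_in_pairwise _ (mem r)) (later_r); last by apply/allP.
  move=> x y xr yr /asboolP[yx uy]; apply/negP => /andP[/asboolP[s B's ax] /asboolP[s' B's' ay]].
  have [g gx] : level p (u (s, x.1)) (t x.1) !=set0.
    apply/set0P/eqP => lx0; move: ax; rewrite lx0 /wmass esum_set0 lte_fin.
    by rewrite ltNge divr_ge0// ltW.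
  have yty : y.2 <= t y.1.
    rewrite leNgt; apply/negP => tyy.
    have [_ /(_ _ B's' _ (t0 _) tyy)] := thinr y yr.
    by rewrite leNgt ay.
  have := lt_le_trans gx (uy s g B's); rewrite ltNge => /negP; apply.
  apply: le_trans yty _; rewrite ler_pM2l// ler_weXn2l ?ler1n// ltnS.
  exact: ltnW.
have /(_ 2^-1) := Cu Q0 uI2 IA IQ; rewrite invr_gt0 invrK => /(_ (ltr0Sn _ 1)).
pose F (j : R * nat) : R :=
  if 2^-1 < `|j.1| `^ p * 2 ^+ j.2.+1 then 2^-1 ^+ j.2.+1 else 0.
rewrite big_mkcond -(big_map (fun i => (i.1, i.2.2)) predT F) IJ big_flatten_nseq.
rewrite (eq_bigr (fun=> 1)); last first.
  move=> x _; rewrite /F /= ger0_norm ?powR_ge0// powRVK ?(ltW (h0 _))// hK ifT.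
    by rewrite -[LHS]mulr_natr natrX hK.
  by rewrite invf_lt1 ?ltr1n.
rewrite big_const_seq count_predT iter_addr_0 sr leNgt => /negP; apply.
have NC : 4 * C ^+ 2 + 4 < N%:R := truncnS_gt _.
have Ce : C * e = 4^-1 by rewrite /e invfM mulrCA mulfV ?mulr1// gt_eqF.
have maxCe : Num.max C e <= C + e by rewrite ge_max lerDl lerDr (ltW C0) (ltW e0).
apply: (@le_lt_trans _ _ (C * (C + e + N%:R * e) * 2)).
  by rewrite ler_pM2r// ler_pM2l// lerD2r.
have -> : C * (C + e + N%:R * e) * 2 = 2 * C ^+ 2 + 2 * (C * e) + 2 * (C * e) * N%:R.
  by ring.
rewrite Ce; lra.
Qed.

End no_embedding.

(** * Continuous linear maps between sums of weak spaces *)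

Section weak_lp_facts.
Context {R : realType} {S : choiceType} {p : R} (p1 : 1 < p) (w : S -> {posnum R}).
Let p0 : 0 < p. Proof. exact: lt_trans p1. Qed.
Local Notation V := (weak_lp p1 w).
Implicit Types (x y : V) (Q : R).

Lemma weak_lpP x y : weak_lp_fun x =1 weak_lp_fun y -> x = y.
Proof. by move=> xy; apply: val_inj; apply/funext. Qed.

Lemma weak_lp_fun0 : weak_lp_fun (0 : V) = 0.
Proof. exact: (raddf0 (\val : V -> S -> R)). Qed.

Lemma weak_lp_funD x y : weak_lp_fun (x + y) = weak_lp_fun x + weak_lp_fun y.
Proof. exact: (raddfD (\val : V -> S -> R)). Qed.

Lemma weak_lp_funZ a x : weak_lp_fun (a *: x) = a *: weak_lp_fun x.
Proof. exact: (linearZZ (\val : V -> S -> R)). Qed.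

Lemma weak_lp_fun_comb (K : Type) (v : K -> V) (I : seq (R * K)) :
  weak_lp_fun (\sum_(i <- I) i.1 *: v i.2) =
  lin_comb (fun k => weak_lp_fun (v k)) I.
Proof.
apply/funext => s; rewrite /lin_comb; elim: I => [|i I IH].
  by rewrite !big_nil weak_lp_fun0.
by rewrite !big_cons -IH weak_lp_funD weak_lp_funZ.
Qed.

Lemma weak_normZE (a : R) (x : S -> R) : a != 0 ->
  weak_norm p w (a *: x) = (`|a|%:E * weak_norm p w x)%E.
Proof.
move=> a0; apply/eqP; rewrite eq_le weak_normZ//=.
have := weak_normZ w a^-1 (a *: x) p0; rewrite scalerA mulVf// scale1r.
by rewrite normfV -(lee_pdivlMl _ _ (_ : 0 < `|a|)) ?normr_gt0.
Qed.

Lemma nbhs0_weak_lpP (A : set V) : nbhs (0 : V) A <->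
  exists2 e : R, 0 < e & forall x, (weak_norm p w x < e%:E)%E -> A x.
Proof.
have E x : weak_norm p w ((0 : V) \- x)%R = weak_norm p w x.
  by rewrite -weak_normN; congr weak_norm; apply/funext => s; rewrite /= opprB subr0.
rewrite -nbhs_entourageE; split=> [[E' [e e0 eE'] E'A]|[e e0 eA]].
  by exists e => // x xe; apply: E'A; rewrite /xsection/= inE; apply: eE'; rewrite E.
exists [set xy : V * V | (weak_norm p w (xy.1 \- xy.2)%R < e%:E)%E].
  by exists e.
by move=> x; rewrite /xsection/= inE /= E; exact: eA.
Qed.

Lemma weak_leW (x : S -> R) Q Q' : Q <= Q' -> weak_le p w x Q -> weak_le p w x Q'.
Proof.
move=> QQ H z z0; apply: le_trans (H z z0) _.
by rewrite lee_fin ler_pM2r ?invr_gt0.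
Qed.

Lemma weak_le0 Q : 0 <= Q -> weak_le p w (0 : V) Q.
Proof.
move=> Q0 z z0; rewrite level0//.
by rewrite /wmass esum_set0 lee_fin divr_ge0// ltW.
Qed.

End weak_lp_facts.

Section bounded.
Context {R : realType} {S1 S2 T1 T2 : choiceType} {p : R} (p1 : 1 < p).
Context (v1 : S1 -> {posnum R}) (v2 : S2 -> {posnum R}).
Context (w1 : T1 -> {posnum R}) (w2 : T2 -> {posnum R}).
Local Notation V := (weak_lp p1 v1 * weak_lp p1 v2)%type.
Local Notation W := (weak_lp p1 w1 * weak_lp p1 w2)%type.
Let p0 : 0 < p. Proof. exact: lt_trans p1. Qed.

Lemma continuous_linear_weak_le (f : {linear V -> W}) : continuous f ->
  exists2 C : R, 0 < C & forall (x : V) (Q : R), 0 < Q ->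
    weak_le p v1 x.1 Q -> weak_le p v2 x.2 Q ->
    weak_le p w1 (f x).1 (C * Q) /\ weak_le p w2 (f x).2 (C * Q).
Proof.
move=> fc; have := fc 0; rewrite /continuous_at linear0 => f0.
pose B := [set y : W | (weak_norm p w1 y.1 < 1%:E)%E /\ (weak_norm p w2 y.2 < 1%:E)%E].
have nB : nbhs (0 : W) B.
  exists ([set y : weak_lp p1 w1 | (weak_norm p w1 y < 1%:E)%E],
          [set y : weak_lp p1 w2 | (weak_norm p w2 y < 1%:E)%E]) => //=.
  by split; apply/nbhs0_weak_lpP; exists 1.
have [[A1 A2] /= [/nbhs0_weak_lpP[e1 e10 A1P] /nbhs0_weak_lpP[e2 e20 A2P]] A12] := f0 _ nB.
pose e := Num.min e1 e2; have e0 : 0 < e by rewrite lt_min e10.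
exists ((2 / e) `^ p) => [|x Q Q0 x1 x2]; first by rewrite powR_gt0// divr_gt0.
pose M := Q `^ p^-1; have M0 : 0 < M by rewrite powR_gt0.
have MQ : M `^ p = Q by rewrite powRVK// ltW.
(* Scales any x of norm at most M into the neighbourhood of 0 of radius e. *)
pose a := e / 2 / M; have a0 : 0 < a by rewrite !divr_gt0.
have aM : a * M < e by rewrite /a divfK ?gt_eqF// gtr_pMr// invf_lt1 ?ltr1n.
have aE : 2 / e * M = a^-1 by rewrite /a !invf_div mulrC.
clearbody a; have small (S : choiceType) (w : S -> {posnum R}) (y : S -> R) : weak_le p w y Q ->
    (weak_norm p w (a *: y) < e%:E)%E.
  rewrite -MQ => /(weak_normP w y p0 (ltW M0)) yM.
  rewrite weak_normZE ?gt_eqF// gtr0_norm//; apply: le_lt_trans (_ : (_ <= (a * M)%:E)%E) _.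
    by rewrite EFinM lee_pmul2l ?lte_fin.
  by rewrite lte_fin.
have big (S : choiceType) (w : S -> {posnum R}) (y : S -> R) :
    (weak_norm p w (a *: y) < 1%:E)%E -> weak_le p w y ((2 / e) `^ p * Q).
  rewrite weak_normZE ?gt_eqF// gtr0_norm// => /ltW y1.
  rewrite -{1}MQ -powRM ?divr_ge0 ?(ltW M0) ?(ltW e0)//; apply/weak_normP => //.
    by rewrite mulr_ge0 ?divr_ge0 ?ltW.
  by rewrite aE -[leRHS]mule1 lee_pdivlMl.
have : B (f (a *: x)).
  apply: A12; split=> /=.
    apply: A1P; apply: lt_le_trans (small _ _ _ x1) _.
    by rewrite lee_fin ge_min lexx.
  apply: A2P; apply: lt_le_trans (small _ _ _ x2) _.
  by rewrite lee_fin ge_min lexx orbT.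
by rewrite linearZ => -[/= y1 y2]; split; apply: big.
Qed.

End bounded.

(** * Absorption of a countable factor *)

Section absorption.

(** A maximal disjoint family of injective sequences in [T] leaves out only
    finitely many points. A point of [T] together with an integer can then be moved
    along the sequence through that point, the exceptional points borrowing one
    fixed sequence. *)
Lemma infinite_setX_nat (T : choiceType) : infinite_set [set: T] ->
  exists f : T * nat -> T, injective f.
Proof.
move=> Tinf; pose seqs := [set v : nat -> T | injective v].
have [E [Einj dE maxE]] := ex_maximal_disjoint_subcollection (fun v : nat -> T => range v) seqs.
pose M := \bigcup_(v in E) range v.
have Mc : finite_set (~` M).
  apply: contrapT => /infiniteP Minf.
  have [v vinj vM] : exists2 v : nat -> T, injective v & forall n, ~ M (v n).
    have /card_leP[h] := Minf.
    exists (fun n => val (h (SigSub (mem_set (I : [set: nat] n))))) => [m n|n].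
      by move=> /val_inj/(inj (mem_set I) (mem_set I))/(congr1 val).
    by case: (h _) => t tM; exact: (set_mem tM).
  have nEv : ~ E v by move=> Ev; apply: (vM 0%N); exists v => //; exists 0%N.
  apply: (maxE (E `|` [set v])).
  - by split=> [|EE]; [exact: subsetUl|apply: nEv; apply: EE; right].
  - by move=> t [/Einj|->].
  - move=> a b [Ea|->] [Eb|->] // [x [[i _ ix] [j _ jx]]].
    + by apply: dE => //; exists x; split; [exists i|exists j].
    + by exfalso; apply: (vM j); exists a => //; exists i => //; rewrite ix.
    + by exfalso; apply: (vM i); exists b => //; exists j => //; rewrite jx.
have [v0 Ev0] : E !=set0.
  apply/set0P/eqP => E0; apply: Tinf.
  by move: Mc; rewrite /M E0 bigcup_set0 setC0.
have /countable_injP[r rinj] := finite_set_countable Mc.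
(* Each point receives a sequence and a mark such that both together determine it:
   its rank in the sequence through it, or its number among the points left out. *)
have tagP x : exists vk : (nat -> T) * (nat + nat), E vk.1 /\
    match vk.2 with inl k => vk.1 k = x | inr k => ~ M x /\ k = r x end.
  have [[v Ev [k _ kx]]|nM] := pselect (M x); first by exists (v, inl k).
  by exists (v0, inr (r x)).
have [t tP] := choice tagP.
have tinj : injective t.
  move=> x y xy; have [_] := tP x; have [_] := tP y; rewrite xy.
  case: (t y).2 => [k -> //|k [nMy ->] [nMx]].
  by move=> /esym; apply: rinj; rewrite inE.
exists (fun xm => (t xm.1).1 (pickle ((t xm.1).2, xm.2))).
move=> [x m] [y n] /= xy; have [Ex _] := tP x; have [Ey _] := tP y.
have txy : (t x).1 = (t y).1.
  apply: dE => //; exists ((t x).1 (pickle ((t x).2, m))).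
  by split; [eexists|rewrite xy; eexists].
move: xy; rewrite txy => /(Einj _ Ey) /(pcan_inj pickleK)[t2 ->].
by congr pair; apply: tinj; rewrite [LHS]surjective_pairing txy t2 -surjective_pairing.
Qed.

(** A point of [D] is determined by the piece containing it and its rank there. *)
Lemma card_le_of_countable_cover (D T : choiceType) (K : countType)
    (F : T * K -> set D) : infinite_set [set: T] ->
  (forall i, countable (F i)) -> (forall s, exists i, F i s) ->
  [set: D] #<= [set: T].
Proof.
move=> /infinite_setX_nat[f finj] cF FD; have [i iF] := choice FD.
have [r rinj] := choice (fun i => (@countable_injP _ (F i) (cF i))).
pose h s := f ((i s).1, pickle ((i s).2, r (i s) s)).
rewrite -(preimage_setT h); apply: card_ge_preimage => s t _ _ /finj[i1].
move=> /(pcan_inj pickleK)[i2]; have E : i s = i t by apply: injective_projections.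
by rewrite E => /rinj; apply; rewrite inE ?iF// -E.
Qed.

End absorption.

Lemma isomorphic_sym (R : numDomainType) (V W : preTopologicalLmodType R) :
  isomorphic V W -> isomorphic W V.
Proof.
move=> [f [g [fg gf fc gc]]].
pose g' : {linear W -> V} := HB.pack g (GRing.isLinear.Build _ _ _ _ g (GRing.can2_linear fg gf)).
by exists g', f.
Qed.

(** * The cardinal inequality given by an isomorphism *)

Section isomorphic_card.
Context {R : realType} {p : R} (p1 : 1 < p).
Let p0 : 0 < p. Proof. exact: lt_trans p1. Qed.

Lemma atom_weak_lp (D : choiceType) (sn : D * nat) :
  atom p sn \in weak_lp_pred p1 (fun sn : D * nat => (2^-1 ^+ sn.2.+1)%:pos).
Proof.
case: sn => s n; rewrite inE /=; apply: (@le_lt_trans _ _ 1%:E); last exact: ltry.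
apply/weak_normP => //; rewrite powR1.
have : uniq [seq i.2 | i <- [seq (1 : R, (s, n)) | s <- [:: s]]] by [].
move=> /(weak_le_atoms p1 1)[_]; rewrite /lin_comb.
have -> : (fun t => \sum_(i <- [seq (1, (s, n)) | s <- [:: s]]) i.1 * atom p i.2 t) =
    atom p (s, n).
  by apply/funext => t; rewrite big_cons big_nil addr0 mul1r.
apply; apply: (@atoms_le_column _ _ _ p1 [:: s] (fun=> 1) n) => _.
by rewrite normr1.
Qed.

Definition bundled_atom (D : choiceType) (sn : D * nat) : weak_lpF p1 D :=
  WeakLp (atom_weak_lp sn).

(** The rows are covered by the countable set of those sent into the first summand
    and by the countable sets of those seen, in a given column, by a given
    coordinate of the second summand. *)
Theorem isomorphic_card_le (G D P : choiceType) :
  infinite_set [set: P] ->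
  isomorphic (weak_lp1 p1 G * weak_lpF p1 D)%type
             (weak_lp1 p1 G * weak_lpF p1 P)%type ->
  [set: D] #<= [set: P].
Proof.
move=> Pinf [f [g [fg gf fc gc]]].
have g0 : g 0 = 0 by rewrite -(linear0 f) fg.
pose g' : {linear _ -> _} := HB.pack g (GRing.isLinear.Build _ _ _ _ g (GRing.can2_linear fg gf)).
have [C1 C10 fC] := continuous_linear_weak_le fc.
have [C2 C20 gC] := continuous_linear_weak_le (f := g') gc.
pose C := Num.max C1 C2; have C0 : 0 < C by rewrite lt_max C10.
pose T (sn : D * nat) := f (0, bundled_atom sn).
pose x (I : seq (R * (D * nat))) : weak_lpF p1 D := \sum_(i <- I) i.1 *: bundled_atom i.2.
have xE I : weak_lp_fun (x I) = lin_comb (atom p) I by rewrite weak_lp_fun_comb.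
have TS a v I : f (0, x ((a, v) :: I)) = a *: T v + f (0, x I).
  rewrite -linearP; congr (f _); rewrite /x big_cons.
  by apply: injective_projections; rewrite /= ?scaler0 ?addr0.
have T0 : f (0, x [::]) = 0 by rewrite /x big_nil (linear0 f).
have D1 a (y z : weak_lp1 p1 G * weak_lpF p1 P) : (a *: y + z).1 = a *: y.1 + z.1 by [].
have D2 a (y z : weak_lp1 p1 G * weak_lpF p1 P) : (a *: y + z).2 = a *: y.2 + z.2 by [].
have TE1 I : weak_lp_fun (f (0, x I)).1 = lin_comb (fun sn => weak_lp_fun (T sn).1) I.
  apply/funext => s; rewrite /lin_comb; elim: I => [|[a v] I IH].
    by rewrite T0 big_nil weak_lp_fun0.
  by rewrite TS D1 weak_lp_funD weak_lp_funZ big_cons -IH.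
have TE2 I : weak_lp_fun (f (0, x I)).2 = lin_comb (fun sn => weak_lp_fun (T sn).2) I.
  apply/funext => s; rewrite /lin_comb; elim: I => [|[a v] I IH].
    by rewrite T0 big_nil weak_lp_fun0.
  by rewrite TS D2 weak_lp_funD weak_lp_funZ big_cons -IH.
have fI I Q : 0 < Q -> uniq [seq i.2 | i <- I] -> atoms_le p I Q ->
    weak_le p unit_weight (lin_comb (fun sn => weak_lp_fun (T sn).1) I) (C * Q) /\
    weak_le p (@dyadic_weight _ P) (lin_comb (fun sn => weak_lp_fun (T sn).2) I) (C * Q).
  move=> Q0 uI /(weak_le_atoms p1 Q uI); rewrite -xE -TE1 -TE2 => xQ.
  have [] := fC (0, x I) Q Q0 (weak_le0 _ _ (ltW Q0)) xQ.
  have CC : C1 * Q <= C * Q by rewrite ler_pM2r// le_max lexx.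
  by split; apply: weak_leW CC _.
pose A := [set s | forall n, (T (s, n)).2 = 0].
have cA : countable A.
  apply: (@no_uncountable_embedding _ _ _ p (fun sn => weak_lp_fun (T sn).1) A C p1 C0).
    by move=> I Q Q0 uI _ /(fI I Q Q0 uI)[].
  move=> I Q Q0 uI IA; rewrite -TE1 => T1Q; apply/(weak_le_atoms p1) => //.
  have T20 : (f (0, x I)).2 = 0.
    apply: weak_lpP => s; rewrite TE2 weak_lp_fun0.
    rewrite /lin_comb big_seq big1// => -[a [t n]] /IA /= At.
    by rewrite At weak_lp_fun0 mulr0.
  have T2Q : weak_le p (@dyadic_weight _ P) (f (0, x I)).2 Q.
    by rewrite T20; apply: weak_le0; exact: ltW.
  have [_] := gC _ _ Q0 T1Q T2Q; rewrite /g' /= fg /= xE; apply: weak_leW.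
  by rewrite ler_pM2r// le_max lexx orbT.
have c2 n (t : P) (m : nat) : countable [set s | [set: D] s /\ (T (s, n)).2 (t, m) != 0].
  apply: (@countable_coord _ _ p [set: D] (fun sn => (T sn).2 (t, m)) (C * 2 ^+ m.+1) p1).
    by rewrite mulr_gt0// exprn_gt0.
  move=> I Q Q0 uI _ /(fI I Q Q0 uI)[_].
  move=> /(weak_le_coord (t, m) (mulr_gt0 C0 Q0)).
  by rewrite /= exprVn ler_pdivrMr ?exprn_gt0// mulrAC.
apply: (@card_le_of_countable_cover _ _ (option (nat * nat))
  (fun o => if o.2 is Some nm then
              [set s | [set: D] s /\ (T (s, nm.1)).2 (o.1, nm.2) != 0] else A)) => //.
  by move=> [t [nm|]]//=.
move=> s; have [As|/existsNP[n Tn]] := pselect (A s).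
  have [t0 _] := infinite_setN0 Pinf; by exists (t0, None).
have [[t m] Ttm] : exists tm, (T (s, n)).2 tm != 0.
  apply: contrapT => H; apply: Tn; apply: weak_lpP => tm.
  rewrite weak_lp_fun0; apply: contrapT => /eqP Ttm; by apply: H; exists tm.
by exists (t, Some (n, m)).
Qed.

End isomorphic_card.

(** * Reindexing along a bijection *)

Section reindexing.
Context {R : realType} {p : R} (p1 : 1 < p).
Context {S T : choiceType} (w : S -> {posnum R}) (v : T -> {posnum R}).
Context (h : S -> T) (k : T -> S) (hk : cancel h k) (kh : cancel k h).
Hypothesis wk : forall t, w (k t) = v t.

Lemma weak_norm_reindex (x : S -> R) : weak_norm p v (x \o k) = weak_norm p w x.
Proof.
rewrite /weak_norm; congr (ereal_sup (image _ _)); apply/funext => c.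
congr (_ * _ `^ _)%E; rewrite /wmass.
rewrite (@reindex_esum _ _ _ [set t | c < `|x (k t)|] [set s | c < `|x s|] k).
  by apply: eq_esum => t _; rewrite wk.
split=> //; first by move=> s t _ _; exact: (can_inj kh).
by move=> s xs; exists (h s); rewrite /= hk.
Qed.

Lemma reindex_weak_lp (x : weak_lp p1 w) : (x : S -> R) \o k \in weak_lp_pred p1 v.
Proof. by have := weak_lp_mem x; rewrite !inE /= weak_norm_reindex. Qed.

Definition reindex (x : weak_lp p1 w) : weak_lp p1 v := WeakLp (reindex_weak_lp x).

Lemma reindex_linear : linear reindex.
Proof.
move=> a x y; apply: weak_lpP => t.
have E z : reindex z t = z (k t) by [].
by rewrite weak_lp_funD weak_lp_funZ E weak_lp_funD weak_lp_funZ.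
Qed.

Lemma reindex_continuous : continuous reindex.
Proof.
move=> x B; rewrite -nbhs_entourageE => -[E [e e0 eE] EB].
rewrite -nbhs_entourageE /=.
exists [set xy : weak_lp p1 w * weak_lp p1 w | (weak_norm p w (xy.1 \- xy.2)%R < e%:E)%E].
  by exists e.
move=> y; rewrite /xsection /= inE /= => xy; apply: EB.
by rewrite /xsection/= inE; apply: eE; rewrite (weak_norm_reindex (x \- y)).
Qed.

End reindexing.

Lemma card_eq_bijective (D T : choiceType) : [set: T] !=set0 ->
  [set: D] #= [set: T] -> exists h : D -> T, bijective h.
Proof.
elim/choicePpointed: T => T; first by rewrite !emptyE => -[].
move=> _ /card_set_bijP[h hbij]; exists h; by rewrite -setTT_bijective.
Qed.

Lemma continuous_map_snd (U V W : topologicalType) (q : V -> W) : continuous q ->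
  continuous (fun x : U * V => (x.1, q x.2)).
Proof.
move=> qc [x y] B [[B1 B2] [/= nB1 nB2] B12].
exists (B1, q @^-1` B2); first by split=> //; exact: qc.
by move=> [a b] [/= aB bB]; exact: (B12 (a, q b)).
Qed.

Lemma card_eq_isomorphic (R : realType) (p : R) (p1 : 1 < p) (G D T : choiceType) :
  [set: T] !=set0 -> [set: D] #= [set: T] ->
  isomorphic (weak_lp1 p1 G * weak_lpF p1 D)%type
             (weak_lp1 p1 G * weak_lpF p1 T)%type.
Proof.
move=> T0 /(card_eq_bijective T0)[h [k hk kh]].
pose H (sn : D * nat) := (h sn.1, sn.2); pose K (tn : T * nat) := (k tn.1, tn.2).
have HK : cancel H K by move=> [s n]; rewrite /K /= hk.
have KH : cancel K H by move=> [t n]; rewrite /H /= kh.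
have wK tn : @dyadic_weight R D (K tn) = @dyadic_weight R T tn by [].
have wH sn : @dyadic_weight R T (H sn) = @dyadic_weight R D sn by [].
pose f (x : weak_lp1 p1 G * weak_lpF p1 D) : weak_lp1 p1 G * weak_lpF p1 T :=
  (x.1, reindex HK KH wK x.2).
pose g (y : weak_lp1 p1 G * weak_lpF p1 T) : weak_lp1 p1 G * weak_lpF p1 D :=
  (y.1, reindex KH HK wH y.2).
have fl : linear f.
  move=> a x y; apply: injective_projections => //=; exact: reindex_linear.
pose f' : {linear _ -> _} := HB.pack f (GRing.isLinear.Build _ _ _ _ f fl).
exists f', g; split.
- move=> [x y]; apply: injective_projections => //=.
  by apply: weak_lpP => s /=; rewrite HK.
- move=> [x y]; apply: injective_projections => //=.
  by apply: weak_lpP => s /=; rewrite KH.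
- by apply: continuous_map_snd; exact: reindex_continuous.
- by apply: continuous_map_snd; exact: reindex_continuous.
Qed.

Theorem theorem25 (R : realType) (p : R) (p1 : 1 < p)
    (Gamma Pi Delta : choiceType) :
  ~ countable [set: Gamma] ->
  card_lt [set: nat] [set: Pi] -> card_lt [set: Pi] [set: Gamma] ->
  card_lt [set: nat] [set: Delta] -> card_lt [set: Delta] [set: Gamma] ->
  isomorphic (weak_lp1 p1 Gamma * weak_lpF p1 Pi)%type
             (weak_lp1 p1 Gamma * weak_lpF p1 Delta)%type
  <-> [set: Pi] #= [set: Delta].
Proof.
move=> _ [/infiniteP Pi_inf _] _ [/infiniteP Delta_inf _] _.
split=> [iso|]; last exact: card_eq_isomorphic (infinite_setN0 Delta_inf).
rewrite card_eq_le (isomorphic_card_le Delta_inf iso) /=.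
exact: isomorphic_card_le Pi_inf (isomorphic_sym iso).
Qed.
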